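(* Let $f\in\mathbb{Q}^2\setminus\mathbb{Z}^2$, let $k\ge 1$, and let $r_1,\dots,r_k\in\mathbb{Q}^2\setminus\{0\}$. Then $$Q_f(r_1,\dots,r_k)\subseteq 1.71\,R_f(r_1,\dots,r_k),$$ that is, for every $s\in Q_f(r_1,\dots,r_k)$ one has $1.71\,s\in R_f(r_1,\dots,r_k)$.
   Context: The Relaxed Corner Polyhedron is $R_f(r_1,\dots,r_k)=\mathrm{Conv}\{s\in\mathbb{R}_+^k : f+\sum_{j=1}^k r_js_j\in\mathbb{Z}^2\}$. A maximal lattice-free convex set in $\mathbb{R}^2$ is a convex set with no point of $\mathbb{Z}^2$ in its interior that is inclusion-maximal with this property. For a maximal lattice-free convex set $B\subset\mathbb{R}^2$ containing $f$ in its interior, $\psi_B:\mathbb{R}^2\to\mathbb{R}_+$ is defined by $\psi_B(0)=0$ and, for $r\ne 0$, $\psi_B(r)=1/\lambda$ if there is $\lambda>0$ with $f+\lambda r$ on the boundary of $B$, and $\psi_B(r)=0$ otherwise. The quadrilateral closure is $$Q_f(r_1,\dots,r_k)=\Big\{s\in\mathbb{R}_+^k:\ \sum_{j=1}^k\psi_B(r_j)s_j\ge 1\ \text{ for every maximal lattice-free quadrilateral } B \text{ with } f \text{ in its interior}\Big\}.$$ Scaling convention: for $\alpha>0$ and a polyhedron $A=\{x: a^ix\ge b_i,\ i=1,\dots,m\}$ with $a^i\ge0$, $b_i\ge 0$, $\alpha A=\{x:\alpha a^ix\ge b_i,\ i=1,\dots,m\}$, i.e. $\alpha A=\{x:\alpha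 x\in A\}$. *)

(* Defs.v *)
From mathcomp Require Import all_boot all_order all_algebra.
From mathcomp Require Import all_classical all_reals all_analysis.
Set Implicit Arguments.
Unset Strict Implicit.
Unset Printing Implicit Defensive.
Import Order.TTheory GRing.Theory Num.Theory.
Import numFieldNormedType.Exports.
Local Open Scope classical_set_scope.
Local Open Scope ring_scope.

Definition conv_hull (R : realType) (E : lmodType R) (A : set E) : set E :=
  smallest (@convex_set R E) A.

Definition boundary (T : topologicalType) (A : set T) : set T :=
  closure A `\` A°.

Definition Q2 (R : realType) : set 'rV[R]_2 :=
  [set x : 'rV[R]_2 | forall i, rational (x 0 i)].

Definition Z2 (R : realType) : set 'rV[R]_2 :=
  [set x : 'rV[R]_2 | forall i, x 0 i \is a Num.int].

Definition lattice_free (R : realType) (B : set 'rV[R]_2) : Prop :=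
  B° `&` @Z2 R = set0.

Definition maximal_lattice_free_convex (R : realType) (B : set 'rV[R]_2)
    : Prop :=
  [/\ convex_set B, lattice_free B &
      forall C : set 'rV[R]_2,
        convex_set C -> lattice_free C -> B `<=` C -> C = B].

(* The four points are vertices: none is in the convex hull of the others, so
   they are distinct, and segments, triangles and single points are excluded. *)
Definition quadrilateral (R : realType) (B : set 'rV[R]_2) : Prop :=
  exists v : 'I_4 -> 'rV[R]_2,
    (forall i, ~ conv_hull [set v j | j in [set j | j != i]] (v i)) /\
    B = conv_hull (range v).

(* If no lambda > 0 puts f + lambda r on the boundary of B, [xget] returns its
   default 0, and 0^-1 = 0.  When f is interior to the convex set B, there is
   at most one such lambda. *)
Definition psi (R : realType) (B : set 'rV[R]_2) (f r : 'rV[R]_2) : R :=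
  if r == 0 then 0
  else (xget 0 [set lambda : R | 0 < lambda /\
                                 boundary B (f + lambda *: r)])^-1.

Definition nonneg_orthant (R : realType) (k : nat) : set 'rV[R]_k :=
  [set s : 'rV[R]_k | forall j, 0 <= s 0 j].

Definition relaxed_corner (R : realType) (k : nat) (f : 'rV[R]_2)
    (r : 'I_k -> 'rV[R]_2) : set 'rV[R]_k :=
  conv_hull (@nonneg_orthant R k `&`
             [set s : 'rV[R]_k | Z2 (f + \sum_(j < k) s 0 j *: r j)]).

Definition quadrilateral_closure (R : realType) (k : nat) (f : 'rV[R]_2)
    (r : 'I_k -> 'rV[R]_2) : set 'rV[R]_k :=
  @nonneg_orthant R k `&`
  [set s : 'rV[R]_k | forall B : set 'rV[R]_2,
     quadrilateral B -> maximal_lattice_free_convex B -> B° f ->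
     1 <= \sum_(j < k) psi B f (r j) * s 0 j].

(* Multiplies the left-hand sides of the inequalities a x >= b defining A by
   alpha: this is the dilation of A by 1 / alpha, not by alpha. *)
Definition scaled (R : realType) (k : nat) (alpha : R) (A : set 'rV[R]_k)
    : set 'rV[R]_k :=
  [set x : 'rV[R]_k | A (alpha *: x)].

(* Main.v *)
Require Import Defs.
From mathcomp Require Import all_boot all_order all_algebra.
From mathcomp Require Import all_classical all_reals all_analysis.
From mathcomp Require Import ring lra zify.
Set Implicit Arguments.
Unset Strict Implicit.
Unset Printing Implicit Defensive.
Import Order.TTheory GRing.Theory Num.Theory.
Import numFieldNormedType.Exports.
Local Open Scope classical_set_scope.
Local Open Scope ring_scope.

(** The bound 2/3 arises as follows. Put G = \sum_j gam_j s_j. Replacing the i-th side of T bounds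
    w_i = S_i / (1 - G) from below, where S_1 + S_2 + S_3 = G, and w_1 + w_2 + w_3 >= 2 is just G >=
    2/3. Two obstacles shape the rest. There are infinitely many feasible t, so separation from
    finitely many of them is carried over by compactness, which leaves only weak inequalities. The
    gap between 1/c and 2/3 pays for raising every weight a little: the weights become positive,
    which makes K bounded, so that finitely many half-planes suffice, and the inequalities become
    strict, which allows integral normals. The covering argument is then pure integer arithmetic,
    and the extremal offsets are attained. The second obstacle is that splits and triangles are not
    quadrilaterals. Their cuts are obtained by tilting the sides slightly, at the price of a small
    increase of all weights that tends to 0. *)

(* Suppose that c s is not in R_f, where c = 1.71 (any c > 3/2 would do). A
   separating hyperplane gives weights gam_j > 0 with \sum_j gam_j t_j > 1
   for all feasible t supported on the support of s, and \sum_j gam_j s_j <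
   2/3. The first property says that the convex hull K of f and the points f
   + r_j / gam_j (s_j > 0) contains no lattice point. Take as few half-planes
   as possible that are disjoint from K and together contain Z^2, and push
   each of them away from K as far as the covering allows. Each then has on
   its boundary a lattice point lying in no other half-plane; by parity there
   are at most four of them, and their position shows that K is contained
   either in a limit of maximal lattice-free quadrilaterals, in which case s
   \in Q_f gives \sum_j gam_j s_j >= 1, or in a triangle T whose sides pass
   in pinwheel position through the corners of a unimodular triangle. In the
   latter case, replacing one side of T by the parallel to the opposite side
   of the unimodular triangle yields a limit of quadrilaterals that cuts off
   only one corner of T; a suitable average of the three cuts so obtained
   gives \sum_j gam_j s_j >= 2/3. *)

(** * Theorem of the alternative *)

Lemma uniform_small (R : realFieldType) (I : finType) (P : I -> R -> Prop) :
  (forall i, exists2 e, 0 < e & forall x, 0 < x <= e -> P i x) ->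
  exists2 e, 0 < e & forall i x, 0 < x <= e -> P i x.
Proof.
move=> h; have /choice[e eP] i : exists e, 0 < e /\ forall x, 0 < x <= e -> P i x.
  by have [e ? ?] := h i; exists e.
exists (\big[Order.min/1]_i e i) => [|i x /andP[x0 xe]].
  by elim/big_ind: _ => [//|x y x0 y0|i _]; [rewrite lt_min x0|have [] := eP i].
by have [_] := eP i; apply; rewrite x0 (le_trans xe)// bigmin_le_cond.
Qed.

Definition dot (R : pzRingType) n (a b : 'rV[R]_n) : R := \sum_i a 0 i * b 0 i.

Section dot.
Context {R : comPzRingType} {n : nat}.
Implicit Types a b c : 'rV[R]_n.

Lemma dotC a b : dot a b = dot b a.
Proof. by apply: eq_bigr => i _; rewrite mulrC. Qed.

Lemma dotDl a b c : dot (a + b) c = dot a c + dot b c.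
Proof. by rewrite -big_split; apply: eq_bigr => i _; rewrite mxE mulrDl. Qed.

Lemma dotZl k a b : dot (k *: a) b = k * dot a b.
Proof. by rewrite mulr_sumr; apply: eq_bigr => i _; rewrite mxE mulrA. Qed.

Lemma dotNl a b : dot (- a) b = - dot a b.
Proof. by rewrite -scaleN1r dotZl mulN1r. Qed.

Lemma dotDr a b c : dot a (b + c) = dot a b + dot a c.
Proof. by rewrite dotC dotDl !(dotC a). Qed.

Lemma dotZr k a b : dot a (k *: b) = k * dot a b.
Proof. by rewrite dotC dotZl dotC. Qed.

Lemma dotNr a b : dot a (- b) = - dot a b.
Proof. by rewrite dotC dotNl dotC. Qed.

Lemma dot_sumr (I : finType) a (F : I -> 'rV[R]_n) :
  dot a (\sum_i F i) = \sum_i dot a (F i).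
Proof.
elim/big_ind2: _ => [|? ? ? ? <- <-|//]; last by rewrite dotDr.
by rewrite /dot big1// => i _; rewrite mxE mulr0.
Qed.

Lemma dot_delta a j : dot a (delta_mx 0 j) = a 0 j.
Proof.
rewrite /dot (bigD1 j)//= big1 ?addr0 => [|i ij]; first by rewrite mxE !eqxx mulr1.
by rewrite mxE eqxx (negbTE ij) mulr0.
Qed.

End dot.

Lemma dot_gt0 (R : realDomainType) n (a : 'rV[R]_n) : a != 0 -> 0 < dot a a.
Proof.
move=> a0; rewrite lt_neqAle eq_sym psumr_neq0 => [|i _]; last first.
  by rewrite -expr2 sqr_ge0.
rewrite sumr_ge0 ?andbT => [|i _]; last by rewrite -expr2 sqr_ge0.
apply: contraNT a0 => /hasPn h; apply/eqP/rowP => i; rewrite mxE.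
have := h i; rewrite mem_index_enum => /(_ isT) /=.
by rewrite -expr2 lt_neqAle sqr_ge0 andbT negbK eq_sym sqrf_eq0 => /eqP.
Qed.

(* Induction on the number of vectors: project the others orthogonally to the
   first one.  A solution of the projected system is tilted into a solution; a
   dependency of it either is one of the original family, or puts the first
   vector in the cone of the others, which therefore decide alone. *)
Lemma gordan (R : realFieldType) n m (w : 'I_m -> 'rV[R]_n) :
  (exists a, forall i, dot a (w i) < 0) \/
  (exists l : 'I_m -> R, [/\ forall i, 0 <= l i, exists i, 0 < l i &
                           \sum_i l i *: w i = 0]).
Proof.
elim: m w => [|m IH] w; first by left; exists 0 => -[].
pose w0 := w ord0; pose w' i := w (lift ord0 i).
pose ext (c : R) (l : 'I_m -> R) i := if unlift ord0 i is Some j then l j else c.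
have extE c l : \sum_i ext c l i *: w i = c *: w0 + \sum_i l i *: w' i.
  rewrite big_ord_recl /ext unlift_none; congr +%R.
  by apply: eq_bigr => i _; rewrite liftK.
have ext_ge0 c l : 0 <= c -> (forall i, 0 <= l i) -> forall i, 0 <= ext c l i.
  by move=> c0 l0 i; rewrite /ext; case: (unlift _ _).
have dep l c : 0 <= c -> (forall i, 0 <= l i) -> (exists i, 0 < l i) ->
  c *: w0 + \sum_i l i *: w' i = 0 ->
  exists l' : 'I_m.+1 -> R, [/\ forall i, 0 <= l' i, exists i, 0 < l' i &
                           \sum_i l' i *: w i = 0].
  move=> c0 l0 [i li] h; exists (ext c l); split; [exact: ext_ge0| |by rewrite extE].
  by exists (lift ord0 i); rewrite /ext liftK.
have [w00|w0N] := eqVneq w0 0.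
  right; exists (ext 1 (fun=> 0)); split; first by apply: ext_ge0.
    by exists ord0; rewrite /ext unlift_none.
  rewrite extE w00 scaler0 add0r big1// => i _; exact: scale0r.
have D0 := dot_gt0 w0N; set D := dot w0 w0 in D0.
have Dn : D != 0 by rewrite gt_eqF.
pose p i := w' i - (dot (w' i) w0 / D) *: w0.
have [[a aP]|[l [l0 lpos lP]]] := IH p.
  left; pose a' := a - (dot a w0 / D) *: w0.
  have a'w0 : dot a' w0 = 0.
    by rewrite /a' dotDl dotNl dotZl -/D divfK// subrr.
  have a'w i : dot a' (w' i) < 0.
    rewrite (_ : dot a' _ = dot a (p i))// /a' /p dotDl dotNl dotZl dotDr dotNr dotZr.
    by rewrite (dotC w0); congr (_ - _); rewrite mulrAC [RHS]mulrAC (mulrC (dot _ w0)).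
  have [e e0 eP] : exists2 e, 0 < e & forall i x, 0 < x <= e ->
      dot a' (w' i) - x * dot w0 (w' i) < 0.
    apply: uniform_small => i; have := a'w i.
    set c := dot a' _; set d := dot w0 _ => c0.
    exists (- c / (1 + `|d|)) => [|x /andP[x0]].
      by rewrite divr_gt0 ?oppr_gt0// ltr_pwDl.
    rewrite ler_pdivlMr ?ltr_pwDl// => h.
    have : - (x * d) <= x * `|d| by rewrite -mulrN ler_wpM2l ?(ltW x0)// -normrN ler_norm.
    nra.
  exists (a' - e *: w0) => i; rewrite dotDl dotNl dotZl.
  have [j ->|->] := unliftP ord0 i; first by apply: eP; rewrite e0 lexx.
  by rewrite -/w0 a'w0 sub0r oppr_lt0 mulr_gt0.
pose c := \sum_i l i * (dot (w' i) w0 / D).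
have lw : \sum_i l i *: w' i = c *: w0.
  have : \sum_i l i *: w' i = \sum_i (l i *: p i + (l i * (dot (w' i) w0 / D)) *: w0).
    by apply: eq_bigr => i _; rewrite scalerBr scalerA subrK.
  by rewrite big_split /= lP add0r -scaler_suml.
have [c0|c0] := leP c 0.
  by right; apply: (dep l (- c)); rewrite ?oppr_ge0// lw scaleNr addNr.
have [[a aP]|[l' [l'0 l'pos l'P]]] := IH w'; last first.
  by right; apply: (dep l' 0); rewrite // scale0r add0r.
left; exists a => i; have [j ->|->] := unliftP ord0 i; first exact: aP.
rewrite -/w0 -(pmulr_rlt0 _ c0) -dotZr -lw dot_sumr.
have [j lj] := lpos; rewrite (bigD1 j)//= dotZr.
rewrite ltr_wnDr ?pmulr_rlt0 ?aP// sumr_le0// => k _.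
by rewrite dotZr mulr_ge0_le0// ltW.
Qed.

Section convex.
Context {R : realType} {E : lmodType R}.
Implicit Types A : set E.

Lemma convex_setP A : convex_set A <->
  forall x y t, 0 <= t <= 1 -> A x -> A y -> A (t *: x + (1 - t) *: y).
Proof.
split=> [cA x y t /andP[t0 t1] Ax Ay|h x y t].
  have := cA x y (Itv01 t0 t1); rewrite !inE; exact.
by rewrite !inE => Ax Ay; apply: h => //; rewrite ge0 le1.
Qed.

Lemma convex3 A x y z a b c : convex_set A -> A x -> A y -> A z ->
  0 <= a -> 0 <= b -> 0 <= c -> a + b + c = 1 ->
  A (a *: x + b *: y + c *: z).
Proof.
move=> /convex_setP cA Ax Ay Az a0 b0 c0 s.
have [c1|c1] := eqVneq c 1.
  have [-> ->] : a = 0 /\ b = 0 by lra.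
  by rewrite c1 !scale0r !add0r scale1r.
have n : 1 - c != 0 by rewrite subr_eq0 eq_sym.
have cp : 0 < 1 - c by rewrite lt_neqAle eq_sym n/=; lra.
have := cA (a / (1 - c) *: x + (1 - a / (1 - c)) *: y) z (1 - c).
rewrite scalerDr !scalerA (_ : (1 - c) * (1 - a / (1 - c)) = b); last first.
  by rewrite mulrBr mulr1 mulrCA divff// mulr1; lra.
rewrite mulrCA divff// mulr1 (_ : 1 - (1 - c) = c); last ring.
apply; [lra| |exact: Az].
apply: cA => //; rewrite divr_ge0 ?(ltW cp)//= ler_pdivrMr// mul1r; lra.
Qed.

Lemma conv_hull_convex A : convex_set (conv_hull A).
Proof.
apply/convex_setP => x y t t01 Ax Ay B [cB AB].
by move/convex_setP : (cB); apply => //; [exact: Ax | exact: Ay].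
Qed.

Lemma sub_conv_hull A : A `<=` conv_hull A.
Proof. exact: sub_gen_smallest. Qed.

Lemma conv_hull_min A B : convex_set B -> A `<=` B -> conv_hull A `<=` B.
Proof. by move=> cB AB; apply: smallest_sub. Qed.

End convex.

Section dot_topology.
Context {R : realType} {n : nat}.

Lemma dot_continuous (u : 'rV[R]_n) : continuous (dot u).
Proof.
apply: continuous_big => [|i _ x]; first exact: add_continuous.
by apply: continuousM; [exact: cst_continuous|exact: coord_continuous].
Qed.

End dot_topology.

(** * Lattice frames and quadrilaterals *)

Lemma dot2E (R : pzRingType) (a b : 'rV[R]_2) :
  dot a b = a 0 0 * b 0 0 + a 0 1 * b 0 1.
Proof.
rewrite /dot !big_ord_recl big_ord0 addr0.
by rewrite (_ : lift ord0 ord0 = 1 :> 'I_2)//; apply: val_inj.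
Qed.

Lemma ord2P (P : 'I_2 -> Prop) : P 0 -> P 1 -> forall i, P i.
Proof.
move=> P0 P1 [[|[|//]] h].
- by rewrite (_ : Ordinal h = 0)//; apply: val_inj.
- by rewrite (_ : Ordinal h = 1)//; apply: val_inj.
Qed.

Definition vec2 (R : nmodType) (a b : R) : 'rV[R]_2 :=
  \row_j (if j == 0 then a else b).

Lemma vec2_0 (R : nmodType) (a b : R) : vec2 a b 0 0 = a.
Proof. by rewrite mxE. Qed.

Lemma vec2_1 (R : nmodType) (a b : R) : vec2 a b 0 1 = b.
Proof. by rewrite mxE. Qed.

(* Affine coordinates on the plane under which the lattice becomes Z^2. *)
Record frame (R : realType) := Frame {
  fu : 'rV[R]_2; fcu : R; fv : 'rV[R]_2; fcv : R;
  fu_int : Z2 fu; fcu_int : fcu \is a Num.int;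
  fv_int : Z2 fv; fcv_int : fcv \is a Num.int;
  fdet : (fu 0 0 * fv 0 1 - fu 0 1 * fv 0 0) ^+ 2 = 1 }.

Section frame.
Context {R : realType}.
Implicit Types (F : frame R) (p q : 'rV[R]_2).

Definition cX F p := dot (fu F) p + fcu F.
Definition cY F p := dot (fv F) p + fcv F.

Let det F := fu F 0 0 * fv F 0 1 - fu F 0 1 * fv F 0 0.

(** Cramer's rule for the inverse of the coordinate map; since [det] squares to 1, multiplying by it
    replaces dividing by it. *)
Definition pt F (x y : R) := vec2
  (det F * (fv F 0 1 * (x - fcu F) - fu F 0 1 * (y - fcv F)))
  (det F * (fu F 0 0 * (y - fcv F) - fv F 0 0 * (x - fcu F))).

Lemma cX_pt F x y : cX F (pt F x y) = x.
Proof.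
rewrite /cX dot2E vec2_0 vec2_1.
transitivity ((det F) ^+ 2 * (x - fcu F) + fcu F); first by rewrite /det; ring.
by rewrite fdet mul1r subrK.
Qed.

Lemma cY_pt F x y : cY F (pt F x y) = y.
Proof.
rewrite /cY dot2E vec2_0 vec2_1.
transitivity ((det F) ^+ 2 * (y - fcv F) + fcv F); first by rewrite /det; ring.
by rewrite fdet mul1r subrK.
Qed.

Lemma ptE F p : pt F (cX F p) (cY F p) = p.
Proof.
apply/rowP; apply: ord2P; rewrite ?(vec2_0, vec2_1) /cX /cY !addrK !dot2E.
  by transitivity ((det F) ^+ 2 * p 0 0); [rewrite /det; ring|rewrite fdet mul1r].
by transitivity ((det F) ^+ 2 * p 0 1); [rewrite /det; ring|rewrite fdet mul1r].
Qed.

Lemma frame_inj F p q : cX F p = cX F q -> cY F p = cY F q -> p = q.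
Proof. by move=> hX hY; rewrite -(ptE F p) -(ptE F q) hX hY. Qed.

Lemma Z2_cX F p : Z2 p -> cX F p \is a Num.int.
Proof.
by move=> pZ; rewrite /cX dot2E rpredD ?fcu_int// rpredD// rpredM//; apply: fu_int.
Qed.

Lemma Z2_cY F p : Z2 p -> cY F p \is a Num.int.
Proof.
by move=> pZ; rewrite /cY dot2E rpredD ?fcv_int// rpredD// rpredM//; apply: fv_int.
Qed.

Lemma Z2_pt F x y : x \is a Num.int -> y \is a Num.int -> Z2 (pt F x y).
Proof.
have dZ : det F \is a Num.int.
  by rewrite rpredB// rpredM//; first [exact: fu_int | exact: fv_int].
move=> xZ yZ; apply: ord2P; rewrite ?(vec2_0, vec2_1) rpredM ?dZ// rpredB//.
all: by rewrite rpredM ?(fu_int F) ?(fv_int F)// rpredB ?fcu_int ?fcv_int.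
Qed.

Lemma cX_comb F p q a b : a + b = 1 -> cX F (a *: p + b *: q) = a * cX F p + b * cX F q.
Proof. by move=> ab; rewrite /cX dotDr !dotZr -[fcu F in LHS]mul1r -ab; ring. Qed.

Lemma cY_comb F p q a b : a + b = 1 -> cY F (a *: p + b *: q) = a * cY F p + b * cY F q.
Proof. by move=> ab; rewrite /cY dotDr !dotZr -[fcv F in LHS]mul1r -ab; ring. Qed.

Lemma cX_comb3 F p q r a b c : a + b + c = 1 ->
  cX F (a *: p + b *: q + c *: r) = a * cX F p + b * cX F q + c * cX F r.
Proof. by move=> ab; rewrite /cX !dotDr !dotZr -[fcu F in LHS]mul1r -ab; ring. Qed.

Lemma cY_comb3 F p q r a b c : a + b + c = 1 ->
  cY F (a *: p + b *: q + c *: r) = a * cY F p + b * cY F q + c * cY F r.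
Proof. by move=> ab; rewrite /cY !dotDr !dotZr -[fcv F in LHS]mul1r -ab; ring. Qed.

Lemma cX_line F p d t : cX F (p + t *: d) = cX F p + t * dot (fu F) d.
Proof. by rewrite /cX dotDr dotZr; ring. Qed.

Lemma cY_line F p d t : cY F (p + t *: d) = cY F p + t * dot (fv F) d.
Proof. by rewrite /cY dotDr dotZr; ring. Qed.

Lemma open_frame_gt0 F a b c : open [set p | 0 < a + b * cX F p + c * cY F p].
Proof.
pose w := b *: fu F + c *: fv F; pose k := a + b * fcu F + c * fcv F.
rewrite (_ : mkset _ = (fun p => dot w p + k) @^-1` [set x | 0 < x]).
  apply: open_comp; last exact: open_gt.
  move=> p _; apply: (@cvgD _ _ _ (nbhs p) _ (dot w) (cst k)); last exact: cvg_cst.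
  exact: dot_continuous.
apply/funext => p; congr (is_true (_ < _)).
by rewrite /cX /cY /w /k dotDl !dotZl; ring.
Qed.

Lemma convex_frame_ge0 F a b c : convex_set [set p | 0 <= a + b * cX F p + c * cY F p].
Proof.
apply/convex_setP => x y t /andP[t0 t1] /= hx hy.
rewrite cX_comb ?cY_comb; [|ring..].
have := mulr_ge0 t0 hx; have : 0 <= (1 - t) by lra.
move=> /mulr_ge0/(_ hy); lra.
Qed.

Lemma convex_frame_gt0 F a b c : convex_set [set p | 0 < a + b * cX F p + c * cY F p].
Proof.
apply/convex_setP => x y t /andP[t0 t1] /= hx hy.
rewrite cX_comb ?cY_comb; [|ring..].
have [->|tn] := eqVneq t 0; first by lra.
have tp : 0 < t by rewrite lt_neqAle eq_sym tn.
have := mulr_gt0 tp hx; have : 0 <= (1 - t) by lra.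
move=> /mulr_ge0/(_ (ltW hy)); lra.
Qed.

Lemma flipX_subproof F : Z2 (- fu F) /\ (1 - fcu F) \is a Num.int /\
  ((- fu F) 0 0 * fv F 0 1 - (- fu F) 0 1 * fv F 0 0) ^+ 2 = 1.
Proof.
split; first by move=> i; rewrite mxE rpredN; apply: fu_int.
by split; [rewrite rpredB ?rpred1 ?fcu_int|rewrite !mxE -[RHS](fdet F); ring].
Qed.

Lemma flipY_subproof F : Z2 (- fv F) /\ (1 - fcv F) \is a Num.int /\
  (fu F 0 0 * (- fv F) 0 1 - fu F 0 1 * (- fv F) 0 0) ^+ 2 = 1.
Proof.
split; first by move=> i; rewrite mxE rpredN; apply: fv_int.
by split; [rewrite rpredB ?rpred1 ?fcv_int|rewrite !mxE -[RHS](fdet F); ring].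
Qed.

(** A reflection of the unit square of the frame. With [flipY], it lets one corner, or one half, of
    a quadrilateral stand for all. *)
Definition flipX F := Frame (proj1 (flipX_subproof F)) (proj1 (proj2 (flipX_subproof F)))
  (@fv_int _ F) (@fcv_int _ F) (proj2 (proj2 (flipX_subproof F))).

Definition flipY F := Frame (@fu_int _ F) (@fcu_int _ F)
  (proj1 (flipY_subproof F)) (proj1 (proj2 (flipY_subproof F)))
  (proj2 (proj2 (flipY_subproof F))).

Lemma cX_flipX F p : cX (flipX F) p = 1 - cX F p.
Proof. by rewrite /cX dotNl/=; ring. Qed.

Lemma cY_flipX F p : cY (flipX F) p = cY F p.
Proof. by []. Qed.

Lemma cX_flipY F p : cX (flipY F) p = cX F p.
Proof. by []. Qed.

Lemma cY_flipY F p : cY (flipY F) p = 1 - cY F p.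
Proof. by rewrite /cY dotNl/=; ring. Qed.

End frame.

Section quad.
Context {R : realType}.
Implicit Types (F : frame R) (p q : 'rV[R]_2) (m : R).

(** The sides pass through (0,0), (1,0), (1,1), (0,1) in this order; for positive parameters each
    has the other three corners strictly inside. *)
Definition quad F m0 m1 m2 m3 : set 'rV[R]_2 :=
  [set p | [/\ 0 <= cX F p + m0 * cY F p,
               0 <= 1 - cX F p + m1 * cY F p,
               0 <= 1 - cX F p + m2 * (1 - cY F p) &
               0 <= cX F p + m3 * (1 - cY F p)]].

Lemma quad_flipX F m0 m1 m2 m3 : quad (flipX F) m0 m1 m2 m3 = quad F m1 m0 m3 m2.
Proof.
by apply/seteqP; rewrite /quad; split=> p /=; rewrite !cX_flipX !cY_flipX => -[h0 h1 h2 h3]; split; lra.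
Qed.

Lemma quad_flipY F m0 m1 m2 m3 : quad (flipY F) m0 m1 m2 m3 = quad F m3 m2 m1 m0.
Proof.
by apply/seteqP; rewrite /quad; split=> p /=; rewrite !cX_flipY !cY_flipY => -[h0 h1 h2 h3]; split; lra.
Qed.

Lemma quad_convex F m0 m1 m2 m3 : convex_set (quad F m0 m1 m2 m3).
Proof.
have := (@convex_frame_ge0 _ F 0 1 m0, @convex_frame_ge0 _ F 1 (-1) m1,
         @convex_frame_ge0 _ F (1 + m2) (-1) (- m2), @convex_frame_ge0 _ F m3 1 (- m3)).
move=> [[[/convex_setP c0 /convex_setP c1] /convex_setP c2] /convex_setP c3].
apply/convex_setP => x y t t01 [x0 x1 x2 x3] [y0 y1 y2 y3].
by split; [have := c0 x y t t01|have := c1 x y t t01|have := c2 x y t t01|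
  have := c3 x y t t01]; move=> /= h; (have {}h := h (ltac:(lra)) (ltac:(lra))); lra.
Qed.

Lemma quad_interior F m0 m1 m2 m3 p :
  0 < cX F p + m0 * cY F p -> 0 < 1 - cX F p + m1 * cY F p ->
  0 < 1 - cX F p + m2 * (1 - cY F p) -> 0 < cX F p + m3 * (1 - cY F p) ->
  (quad F m0 m1 m2 m3)° p.
Proof.
move=> h0 h1 h2 h3.
have o := openI (openI (@open_frame_gt0 _ F 0 1 m0) (@open_frame_gt0 _ F 1 (-1) m1))
 (openI (@open_frame_gt0 _ F (1 + m2) (-1) (- m2)) (@open_frame_gt0 _ F m3 1 (- m3))).
apply: filterS (open_nbhs_nbhs (conj o _)) => [q [[/= q0 q1] [/= q2 q3]]|].
  by split; lra.
by split; split=> /=; lra.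
Qed.
End quad.

Section vertices.
Context {R : realType}.
Implicit Types (F : frame R) (p q : 'rV[R]_2) (m : R).

Lemma pt_flipX F x y : pt (flipX F) x y = pt F (1 - x) y.
Proof.
apply: (@frame_inj _ (flipX F)); rewrite ?cX_pt ?cY_pt.
  by rewrite cX_flipX cX_pt; ring.
by rewrite cY_flipX cY_pt.
Qed.

Lemma interior_pt F (A : set 'rV[R]_2) p a b : A° p ->
  exists2 t, 0 < t & A (pt F (cX F p + t * a) (cY F p + t * b)).
Proof.
move=> /nbhs_ballP[e /= e0 eA].
pose d := pt F (cX F p + a) (cY F p + b) - p.
have d1 : 0 < 1 + `|d| by rewrite ltr_pwDl.
exists (e / (1 + `|d|)); first by rewrite divr_gt0.
set t := _ / _; rewrite (_ : pt _ _ _ = p + t *: d).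
  apply: eA; rewrite -ball_normE /= opprD addrA subrr sub0r normrN normrZ.
  rewrite ger0_norm ?divr_ge0 ?ltW// /t mulrAC ltr_pdivrMr// ltr_pM2l//.
  by rewrite ltrDr.
apply: (@frame_inj _ F); rewrite ?cX_line ?cY_line ?cX_pt ?cY_pt /d dotDr dotNr.
  by have := cX_pt F (cX F p + a) (cY F p + b); rewrite /cX => h; congr +%R; congr *%R; lra.
by have := cY_pt F (cX F p + a) (cY F p + b); rewrite /cY => h; congr +%R; congr *%R; lra.
Qed.

Lemma int_le0_ge1 (x : R) : x \is a Num.int -> x <= 0 \/ 1 <= x.
Proof.
move=> /intrP[m ->]; rewrite -[1]/(1%:~R) -[0]/(0%:~R) !ler_int.
by have [?|?] := leP m 0; [left|right]; lia.
Qed.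

(** No integer lies strictly between 0 and 1, so a lattice point lies in the quadrant outside one
    corner of the unit square. There a small horizontal step outward violates the side through that
    corner. *)
Lemma quad_lattice_free F m0 m1 m2 m3 :
  0 < m0 -> 0 < m1 -> 0 < m2 -> 0 < m3 -> lattice_free (quad F m0 m1 m2 m3).
Proof.
move=> m0p m1p m2p m3p; apply/seteqP; split => // p [pi pZ].
have [x0|x1] := int_le0_ge1 (Z2_cX F pZ); have [y0|y1] := int_le0_ge1 (Z2_cY F pZ).
- have [t t0 []] := interior_pt F (-1) 0 pi.
  by rewrite cX_pt cY_pt => h _ _ _; nra.
- have [t t0 []] := interior_pt F (-1) 0 pi.
  by rewrite cX_pt cY_pt => _ _ _ h; nra.
- have [t t0 []] := interior_pt F 1 0 pi.
  by rewrite cX_pt cY_pt => _ h _ _; nra.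
- have [t t0 []] := interior_pt F 1 0 pi.
  by rewrite cX_pt cY_pt => _ _ h _; nra.
Qed.

(** The four vertices, each the intersection of two consecutive sides. *)
Definition quad_bot F m0 m1 := pt F (m0 / (m0 + m1)) (- (m0 + m1)^-1).
Definition quad_right F m1 m2 := pt F (1 + m1 * m2 / (m1 + m2)) (m2 / (m1 + m2)).
Definition quad_top F m2 m3 := pt F (m3 / (m2 + m3)) (1 + (m2 + m3)^-1).
Definition quad_left F m3 m0 := pt F (- (m0 * m3 / (m0 + m3))) (m3 / (m0 + m3)).

(* The sign of this form tells on which side of the diagonal joining the bottom
   vertex to the top one a point lies. *)
Let diag m0 m1 m2 m3 (x y : R) :=
  x * ((m0 + m1) * (m2 + m3) + (m0 + m1) + (m2 + m3))
  - y * (m3 * (m0 + m1) - m0 * (m2 + m3)) - (m0 * (m2 + m3) + m0 + m3).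

(** The barycentric coordinates [b0], [b1], [b2] are the forms of the opposite sides divided by
    their values at the vertices. The half left of the diagonal follows by reflection. *)
Lemma right_triangle F m0 m1 m2 m3 (A : set 'rV[R]_2) p :
  0 < m0 -> 0 < m1 -> 0 < m2 -> 0 < m3 ->
  convex_set A -> A (quad_bot F m0 m1) -> A (quad_right F m1 m2) ->
  A (quad_top F m2 m3) ->
  0 <= 1 - cX F p + m1 * cY F p -> 0 <= 1 - cX F p + m2 * (1 - cY F p) ->
  0 <= diag m0 m1 m2 m3 (cX F p) (cY F p) -> A p.
Proof.
move=> m0p m1p m2p m3p cA Ab Ar At; rewrite /diag.
set x := cX F p; set y := cY F p => h1 h2 hD.
have M0 : 0 < m0 + m1 by rewrite addr_gt0.
have N0 : 0 < m2 + m3 by rewrite addr_gt0.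
have K0 : 0 < m1 + m2 by rewrite addr_gt0.
pose P1 := m1 + m2 + m1 * m2 + m0 * m2; pose P2 := m1 + m2 + m1 * m2 + m1 * m3.
have P10 : 0 < P1 by rewrite /P1 !addr_gt0 ?mulr_gt0.
have P20 : 0 < P2 by rewrite /P2 !addr_gt0 ?mulr_gt0.
pose b0 := (1 - x + m2 * (1 - y)) * (m0 + m1) / P1.
pose b2 := (1 - x + m1 * y) * (m2 + m3) / P2.
pose b1 := (m1 + m2) * (x * ((m0 + m1) * (m2 + m3) + (m0 + m1) + (m2 + m3))
  - y * (m3 * (m0 + m1) - m0 * (m2 + m3)) - (m0 * (m2 + m3) + m0 + m3)) / (P1 * P2).
have ng : [/\ P1 != 0, P2 != 0, m0 + m1 != 0, m2 + m3 != 0 & m1 + m2 != 0].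
  by rewrite !gt_eqF.
have [n1 n2 n3 n4 n5] := ng.
have s : b0 + b1 + b2 = 1.
  rewrite /b0 /b1 /b2; move: n1 n2; rewrite /P1 /P2 => n1 n2; field.
  by rewrite n1 n2.
rewrite (_ : p = b0 *: quad_bot F m0 m1 + b1 *: quad_right F m1 m2
                 + b2 *: quad_top F m2 m3).
  apply: convex3 => //; rewrite /b0 /b1 /b2 divr_ge0 ?mulr_ge0 //; exact: ltW.
apply: (@frame_inj _ F); rewrite ?cX_comb3 ?cY_comb3 // ?cX_pt ?cY_pt -/x -/y.
  rewrite /b0 /b1 /b2; move: n1 n2; rewrite /P1 /P2 => n1 n2; field.
  by rewrite n1 n2 n3 n4 n5.
rewrite /b0 /b1 /b2; move: n1 n2; rewrite /P1 /P2 => n1 n2; field.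
by rewrite n1 n2 n3 n4 n5.
Qed.

Lemma quad_subhull F m0 m1 m2 m3 (A : set 'rV[R]_2) :
  0 < m0 -> 0 < m1 -> 0 < m2 -> 0 < m3 ->
  convex_set A -> A (quad_bot F m0 m1) -> A (quad_right F m1 m2) ->
  A (quad_top F m2 m3) -> A (quad_left F m3 m0) ->
  quad F m0 m1 m2 m3 `<=` A.
Proof.
move=> m0p m1p m2p m3p cA Ab Ar At Al p [h0 h1 h2 h3].
have M0 : m0 + m1 != 0 by rewrite gt_eqF ?addr_gt0.
have N0 : m2 + m3 != 0 by rewrite gt_eqF ?addr_gt0.
have K0 : m0 + m3 != 0 by rewrite gt_eqF ?addr_gt0.
have [D|/ltW D] := leP 0 (diag m0 m1 m2 m3 (cX F p) (cY F p)).
  exact: (right_triangle m0p m1p m2p m3p cA Ab Ar At).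
apply: (@right_triangle (flipX F) m1 m0 m3 m2) => //.
- by rewrite /quad_bot pt_flipX (_ : 1 - _ = m0 / (m0 + m1)) ?(addrC m1)//; field.
- rewrite /quad_right pt_flipX.
  by rewrite (_ : 1 - _ = - (m0 * m3 / (m0 + m3)))//; field.
- by rewrite /quad_top pt_flipX (_ : 1 - _ = m3 / (m2 + m3)) ?(addrC m3)//; field.
- by rewrite cX_flipX cY_flipX; lra.
- by rewrite cX_flipX cY_flipX; lra.
- by rewrite cX_flipX cY_flipX; move: D; rewrite /diag; lra.
Qed.

Definition quad_vertex F m0 m1 m2 m3 (i : 'I_4) : 'rV[R]_2 :=
  nth 0 [:: quad_bot F m0 m1; quad_right F m1 m2; quad_top F m2 m3;
            quad_left F m3 m0] i.

Lemma quadrilateral_quad F m0 m1 m2 m3 :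
  0 < m0 -> 0 < m1 -> 0 < m2 -> 0 < m3 -> quadrilateral (quad F m0 m1 m2 m3).
Proof.
move=> m0p m1p m2p m3p; exists (quad_vertex F m0 m1 m2 m3).
have sp (a b : R) : 0 < a -> 0 < b -> 0 < (a + b)^-1 by move=> *; rewrite invr_gt0 addr_gt0.
have M0 := sp _ _ m0p m1p; have N0 := sp _ _ m2p m3p.
have K0 := sp _ _ m1p m2p; have L0 := sp _ _ m0p m3p.

have sk (a b x : R) : 0 < a -> 0 < b -> (a + b) * (x / (a + b)) = x.
  by move=> a0 b0; rewrite mulrCA divff ?mulr1// gt_eqF// addr_gt0.
have below (c a b : R) : 0 < c -> 0 < a -> 0 < b ->
    [/\ 0 < c * (a / (a + b)), c * (a / (a + b)) < c,
        0 < c * (b / (a + b)) & c * (b / (a + b)) < c].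
  move=> c0 a0 b0; have ab := addr_gt0 a0 b0.
  have f (x y : R) : 0 < y -> 0 < x -> x < y -> 0 < x / y /\ x / y < 1.
    by move=> y0 x0 xy; rewrite divr_gt0// ltr_pdivrMr// mul1r.
  have [f1 f2] := f a _ ab a0 (ltac:(lra)); have [f3 f4] := f b _ ab b0 (ltac:(lra)).
  by split; [exact: mulr_gt0|rewrite gtr_pMr|exact: mulr_gt0|rewrite gtr_pMr].
have p12 := mulr_gt0 m1p m2p; have p03 := mulr_gt0 m0p m3p.
have s01 := addr_gt0 m0p m1p; have s12 := addr_gt0 m1p m2p.
have s23 := addr_gt0 m2p m3p; have s03 := addr_gt0 m0p m3p.
split.
  (* A vertex is cut off from the other three by an axis-parallel line through it: it is the only
     lowest, rightmost, highest or leftmost one. *)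
  have key (i : 'I_4) a b c :
      ~ (0 < a + b * cX F (quad_vertex F m0 m1 m2 m3 i)
             + c * cY F (quad_vertex F m0 m1 m2 m3 i)) ->
      (forall j : 'I_4, j != i -> 0 < a + b * cX F (quad_vertex F m0 m1 m2 m3 j)
             + c * cY F (quad_vertex F m0 m1 m2 m3 j)) ->
      ~ conv_hull [set quad_vertex F m0 m1 m2 m3 j | j in [set j | j != i]]
                  (quad_vertex F m0 m1 m2 m3 i).
    move=> hi hj; apply: contra_not hi.
    apply: (conv_hull_min (@convex_frame_gt0 _ F a b c)) => _ [j ji <-].
    exact: hj.
  case=> [[|[|[|[|//]]]] h].
  - apply: (key _ 1 0 (m0 + m1)).
      by rewrite /quad_vertex /= cX_pt cY_pt; have := sk _ _ 1 m0p m1p; lra.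
    case=> [[|[|[|[|//]]]] h'] //= _; rewrite /quad_vertex /= cX_pt cY_pt.
    + by have [] := below _ _ _ s01 m1p m2p; lra.
    + by have := mulr_gt0 s01 N0; lra.
    + by have [] := below _ _ _ s01 m0p m3p; lra.
  - apply: (key _ (m1 + m2 + m1 * m2) (- (m1 + m2)) 0).
      by rewrite /quad_vertex /= cX_pt cY_pt; have := sk _ _ (m1 * m2) m1p m2p; lra.
    case=> [[|[|[|[|//]]]] h'] //= _; rewrite /quad_vertex /= cX_pt cY_pt.
    + by have [] := below _ _ _ s12 m0p m1p; lra.
    + by have [] := below _ _ _ s12 m2p m3p; lra.
    + by have [] := below _ _ _ (mulr_gt0 s12 m0p) m0p m3p; lra.
  - apply: (key _ (1 + m2 + m3) 0 (- (m2 + m3))).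
      by rewrite /quad_vertex /= cX_pt cY_pt; have := sk _ _ 1 m2p m3p; lra.
    case=> [[|[|[|[|//]]]] h'] //= _; rewrite /quad_vertex /= cX_pt cY_pt.
    + by have := mulr_gt0 s23 M0; lra.
    + by have [] := below _ _ _ s23 m1p m2p; lra.
    + by have [] := below _ _ _ s23 m0p m3p; lra.
  - apply: (key _ (m0 * m3) (m0 + m3) 0).
      by rewrite /quad_vertex /= cX_pt cY_pt; have := sk _ _ (m0 * m3) m0p m3p; lra.
    case=> [[|[|[|[|//]]]] h'] //= _; rewrite /quad_vertex /= cX_pt cY_pt.
    + by have [] := below _ _ _ s03 m0p m1p; lra.
    + by have [] := below _ _ _ (mulr_gt0 s03 m1p) m1p m2p; lra.
    + by have [] := below _ _ _ s03 m2p m3p; lra.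
have mem i : conv_hull (range (quad_vertex F m0 m1 m2 m3)) (quad_vertex F m0 m1 m2 m3 i).
  by apply: sub_conv_hull; exists i.
apply/seteqP; split.
  apply: quad_subhull => //; first exact: conv_hull_convex.
  - exact: (mem (@Ordinal 4 0 isT)).
  - exact: (mem (@Ordinal 4 1 isT)).
  - exact: (mem (@Ordinal 4 2 isT)).
  - exact: (mem (@Ordinal 4 3 isT)).
apply: conv_hull_min; first exact: quad_convex.
move=> _ [[[|[|[|[|//]]]] h] _ <-]; rewrite /quad_vertex /quad /= !cX_pt !cY_pt.
- have := sk _ _ 1 m0p m1p; have [] := below _ _ _ ltr01 m0p m1p.
  have := mulr_gt0 m2p M0; have := mulr_gt0 m3p M0.
  by split; lra.
- have := sk _ _ m2 m1p m2p; have [] := below _ _ _ m3p m1p m2p.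
  have [] := below _ _ _ m0p m1p m2p; have [] := below _ _ _ m1p m1p m2p.
  by split; lra.
- have := sk _ _ 1 m2p m3p; have [] := below _ _ _ ltr01 m2p m3p.
  have := mulr_gt0 m0p N0; have := mulr_gt0 m1p N0.
  by split; lra.
- have := sk _ _ m3 m0p m3p; have [] := below _ _ _ m1p m0p m3p.
  have [] := below _ _ _ m2p m0p m3p; have [] := below _ _ _ m0p m0p m3p.
  by split; lra.
Qed.
End vertices.

(** * Maximality of the quadrilaterals *)

Section maximal.
Context {R : realType}.
Implicit Types (F : frame R) (p q z : 'rV[R]_2) (m : R).

(** [l] is the barycentric coordinate of [z] at [q], in a triangle whose opposite side lies on the
    line [s] = 0 around the origin; the last two conditions concern the other coordinates. *)
Lemma corner_triangle F m0 alpha beta (C : set 'rV[R]_2) q z :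
  0 < alpha -> 0 < beta -> convex_set C ->
  C (pt F (- (m0 * alpha)) alpha) -> C (pt F (m0 * beta) (- beta)) -> C q ->
  let s p := cX F p + m0 * cY F p in
  let l := s z / s q in
  s q != 0 -> 0 <= l ->
  0 <= (1 - l) * beta + (cY F z - l * cY F q) ->
  0 <= (1 - l) * alpha - (cY F z - l * cY F q) -> C z.
Proof.
move=> a0 b0 cC Ca Cb Cq s l sq0 l0 h1 h2.
have ab : 0 < alpha + beta by exact: addr_gt0.
have abn : alpha + beta != 0 by rewrite gt_eqF.
set t := cY F z - l * cY F q in h1 h2.
pose mu := ((1 - l) * beta + t) / (alpha + beta).
pose nu := ((1 - l) * alpha - t) / (alpha + beta).
have sE : l + mu + nu = 1 by rewrite /mu /nu; field.
rewrite (_ : z = l *: q + mu *: pt F (- (m0 * alpha)) alpha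
                 + nu *: pt F (m0 * beta) (- beta)).
  by apply: convex3 => //; rewrite divr_ge0 ?(ltW ab).
have tE : mu * alpha - nu * beta = t by rewrite /mu /nu; field.
apply: (@frame_inj _ F); rewrite ?cX_comb3 ?cY_comb3 // ?cX_pt ?cY_pt.
  rewrite (_ : _ + _ + _ = l * cX F q - m0 * (mu * alpha - nu * beta)); last ring.
  rewrite tE /t (_ : _ - _ = l * s q - m0 * cY F z); last by rewrite /s; ring.
  by rewrite /l divfK// /s; ring.
rewrite (_ : _ + _ + _ = l * cY F q + (mu * alpha - nu * beta)); last ring.
by rewrite tE /t addrC subrK.
Qed.

(** [C] contains the side through the corner (0,0), with [p] beyond it and (1,1) on the inner side;
    the two triangles over this side together fill a neighbourhood of the corner. *)
Lemma beyond_corner F m0 m1 m2 m3 (C : set 'rV[R]_2) p :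
  0 < m0 -> 0 < m1 -> 0 < m2 -> 0 < m3 ->
  convex_set C -> quad F m0 m1 m2 m3 `<=` C -> C p ->
  cX F p + m0 * cY F p < 0 -> C° (pt F 0 0).
Proof.
move=> m0p m1p m2p m3p cC BC Cp sp.
have s03 := addr_gt0 m0p m3p; have s01 := addr_gt0 m0p m1p.
pose alpha := m3 / (m0 + m3); pose beta := (m0 + m1)^-1.
have a0 : 0 < alpha by rewrite divr_gt0.
have b0 : 0 < beta by rewrite invr_gt0.
have aE : (m0 + m3) * alpha = m3 by rewrite mulrCA divff ?mulr1// gt_eqF.
have bE : (m0 + m1) * beta = 1 by rewrite divff// gt_eqF.
have a1 : 0 < 1 - alpha by rewrite subr_gt0 ltr_pdivrMr//; lra.
have Ca : C (pt F (- (m0 * alpha)) alpha).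
  apply: BC; rewrite /quad /= cX_pt cY_pt; have := mulr_gt0 m0p a0.
  have := mulr_gt0 m1p a0; have := mulr_gt0 m2p a1; by split; lra.
have Cb : C (pt F (m0 * beta) (- beta)).
  apply: BC; rewrite /quad /= cX_pt cY_pt; have := mulr_gt0 m0p b0.
  have := mulr_gt0 m1p b0; have := mulr_gt0 m2p b0; have := mulr_gt0 m3p b0.
  by split; lra.
pose q := pt F 1 1.
have Cq : C q by apply: BC; rewrite /quad /q /= cX_pt cY_pt; split; lra.
have sq : 0 < cX F q + m0 * cY F q by rewrite cX_pt cY_pt; lra.
have tri := corner_triangle a0 b0 cC Ca Cb.
pose u w := (cX F w + m0 * cY F w)^-1.
(* The last two conditions of [corner_triangle] with apex [w], as affine forms in [z]. At the corner
   they reduce to [0 < beta] and [0 < alpha], so they persist nearby. *)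
have o w := openI
  (@open_frame_gt0 _ F beta (- (beta + cY F w) * u w) (1 - m0 * (beta + cY F w) * u w))
  (@open_frame_gt0 _ F alpha ((cY F w - alpha) * u w) (m0 * (cY F w - alpha) * u w - 1)).
have oo := openI (o q) (o p).
apply: filterS (open_nbhs_nbhs (conj oo _)); last first.
  by do 2 split; rewrite /= cX_pt cY_pt !mulr0 !addr0.
move=> z [[/= q1 q2] [/= p1 p2]].
have [sz|/ltW sz] := leP 0 (cX F z + m0 * cY F z).
  apply: (tri _ _ Cq); rewrite ?gt_eqF// ?divr_ge0 ?(ltW sq)// -/(u q); lra.
apply: (tri _ _ Cp); rewrite ?lt_eqF// -/(u p); [|lra|lra].
by rewrite mulr_le0// invr_le0 ltW.
Qed.

Lemma quad_maximal F m0 m1 m2 m3 :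
  0 < m0 -> 0 < m1 -> 0 < m2 -> 0 < m3 ->
  maximal_lattice_free_convex (quad F m0 m1 m2 m3).
Proof.
move=> m0p m1p m2p m3p; split; [exact: quad_convex|exact: quad_lattice_free|].
move=> C cC Clf BC; apply/seteqP; split => // p Cp.
have noint F' : C° (pt F' 0 0) -> False.
  move=> Ci; have : (C° `&` @Z2 R) (pt F' 0 0) by split => //; apply: Z2_pt.
  by rewrite Clf.
have key F' n0 n1 n2 n3 : 0 < n0 -> 0 < n1 -> 0 < n2 -> 0 < n3 ->
    quad F' n0 n1 n2 n3 `<=` C -> 0 <= cX F' p + n0 * cY F' p.
  move=> n0p n1p n2p n3p qC; rewrite leNgt; apply/negP => h.
  exact: (noint F' (beyond_corner n0p n1p n2p n3p cC qC Cp h)).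
split; first exact: (@key F m0 m1 m2 m3).
- have := @key (flipX F) m1 m0 m3 m2; rewrite quad_flipX cX_flipX cY_flipX; exact.
- have := @key (flipY (flipX F)) m2 m3 m0 m1.
  rewrite quad_flipY quad_flipX cX_flipY cY_flipY cX_flipX cY_flipX; exact.
- have := @key (flipY F) m3 m2 m1 m0; rewrite quad_flipY cX_flipY cY_flipY; exact.
Qed.

End maximal.

(** * Cuts from quadrilaterals and their limits *)

Section cut.
Context {R : realType} (k : nat) (f : 'rV[R]_2) (r : 'I_k -> 'rV[R]_2).
Hypothesis r0 : forall j, r j <> 0.
Variable s : 'rV[R]_k.
Hypothesis sQ : quadrilateral_closure f r s.
Implicit Types (F : frame R) (m : R).

(** The last four conditions put [f + g^-1 *: d] in the quadrilateral, multiplied out so that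
    [g = 0] means a recession direction. Then [f + l *: d] is interior as long as [g * l < 1]. *)
Lemma psi_quad_le F m0 m1 m2 m3 d (g : R) : d <> 0 -> 0 <= g ->
  let B := quad F m0 m1 m2 m3 in
  let x := cX F f in let y := cY F f in
  let dx := dot (fu F) d in let dy := dot (fv F) d in
  0 < x + m0 * y -> 0 < 1 - x + m1 * y ->
  0 < 1 - x + m2 * (1 - y) -> 0 < x + m3 * (1 - y) ->
  0 <= g * (x + m0 * y) + (dx + m0 * dy) ->
  0 <= g * (1 - x + m1 * y) + (- dx + m1 * dy) ->
  0 <= g * (1 - x + m2 * (1 - y)) + (- dx - m2 * dy) ->
  0 <= g * (x + m3 * (1 - y)) + (dx - m3 * dy) ->
  psi B f d <= g.
Proof.
move=> d0 g0 B x y dx dy f0 f1 f2 f3 g0' g1 g2 g3.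
rewrite /psi; case: eqP => // _.
case: xgetP => [l _ [l0 [_ ni]]|_]; last by rewrite invr0.
rewrite -[_^-1]mul1r ler_pdivrMr// leNgt; apply/negP => gl.
apply: ni; apply: quad_interior; rewrite cX_line cY_line -/x -/y -/dx -/dy.
- by have := mulr_ge0 (ltW l0) g0'; have := mulr_gt0 f0 (ltac:(lra) : 0 < 1 - g * l); lra.
- by have := mulr_ge0 (ltW l0) g1; have := mulr_gt0 f1 (ltac:(lra) : 0 < 1 - g * l); lra.
- by have := mulr_ge0 (ltW l0) g2; have := mulr_gt0 f2 (ltac:(lra) : 0 < 1 - g * l); lra.
- by have := mulr_ge0 (ltW l0) g3; have := mulr_gt0 f3 (ltac:(lra) : 0 < 1 - g * l); lra.
Qed.

(** A side with [p] or [q] zero is tilted by adding [x] to both; the strict slack at [f], multiplied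
    by [eta], absorbs the error. *)
Lemma corner_perturb (p q A B a b g eta : R) : 0 <= p -> 0 <= q ->
  0 < p * A + q * B -> 0 <= g * (p * A + q * B) + (p * a + q * b) -> 0 < eta ->
  exists2 e, 0 < e & forall x, 0 < x <= e -> let m := (q + x) / (p + x) in
    0 < A + m * B /\ 0 <= (g + eta) * (A + m * B) + (a + m * b).
Proof.
move=> p0 q0 AB gAB eta0.
have small (u v : R) : 0 < u ->
    exists2 e, 0 < e & forall x, 0 < x <= e -> 0 < u + x * v.
  move=> u0; have v0 : 0 < 1 + `|v| by rewrite ltr_pwDl.
  exists (u / (1 + `|v|)) => [|x /andP[x0]]; first by rewrite divr_gt0.
  rewrite ler_pdivlMr// => h.
  have : - (x * `|v|) <= x * v by rewrite -mulrN ler_wpM2l ?(ltW x0)// lerNnormlW.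
  lra.
have [e1 e10 h1] := small _ (A + B) AB.
have [e2 e20 h2] := small _ ((g + eta) * (A + B) + (a + b)) (mulr_gt0 eta0 AB).
exists (Order.min e1 e2) => [|x]; first by rewrite lt_min e10.
rewrite le_min => /andP[x0 /andP[xe1 xe2]] m.
have px : 0 < p + x by exact: ltr_wpDl.
have E u v : u + m * v = ((p * u + q * v) + x * (u + v)) / (p + x).
  by rewrite /m; field; rewrite gt_eqF.
rewrite !E mulrA -mulrDl; split.
  by rewrite divr_gt0// h1// x0.
rewrite divr_ge0 ?(ltW px)//.
have := h2 x; rewrite x0 xe2 => /(_ isT); lra.
Qed.

(* Nonnegative coefficients also allow splits and triangles, which are limits
   of quadrilaterals with lattice points at the corners of a unit square. *)
Lemma quad_cut F p0 q0 p1 q1 p2 q2 p3 q3 (g : 'I_k -> R) :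
  let x := cX F f in let y := cY F f in
  let dx j := dot (fu F) (r j) in let dy j := dot (fv F) (r j) in
  [/\ 0 <= p0, 0 <= p1, 0 <= p2 & 0 <= p3] ->
  [/\ 0 <= q0, 0 <= q1, 0 <= q2 & 0 <= q3] ->
  0 < p0 * x + q0 * y -> 0 < p1 * (1 - x) + q1 * y ->
  0 < p2 * (1 - x) + q2 * (1 - y) -> 0 < p3 * x + q3 * (1 - y) ->
  (forall j, 0 < s 0 j ->
    0 <= g j /\
    [/\ 0 <= g j * (p0 * x + q0 * y) + (p0 * dx j + q0 * dy j),
     0 <= g j * (p1 * (1 - x) + q1 * y) + (p1 * - dx j + q1 * dy j),
     0 <= g j * (p2 * (1 - x) + q2 * (1 - y)) + (p2 * - dx j + q2 * - dy j) &
     0 <= g j * (p3 * x + q3 * (1 - y)) + (p3 * dx j + q3 * - dy j)]) ->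
  1 <= \sum_j g j * s 0 j.
Proof.
move=> x y dx dy [p00 p10 p20 p30] [q00 q10 q20 q30] f0 f1 f2 f3 hg.
have s0 j : 0 <= s 0 j by have [h _] := sQ; exact: h.
suff main eta : 0 < eta -> 1 <= \sum_j (g j + eta) * s 0 j.
  rewrite leNgt; apply/negP => lt1.
  have S0 : 0 <= \sum_j s 0 j by apply: sumr_ge0.
  pose eta := (1 - \sum_j g j * s 0 j) / (2 * (1 + \sum_j s 0 j)).
  have D0 : 0 < 2 * (1 + \sum_j s 0 j) by lra.
  have eta0 : 0 < eta by rewrite divr_gt0//; lra.
  have := main _ eta0.
  rewrite (_ : \sum_j _ = \sum_j g j * s 0 j + eta * \sum_j s 0 j); last first.
    by rewrite mulr_sumr -big_split; apply: eq_bigr => j _; rewrite mulrDl.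
  have : eta * (2 * (1 + \sum_j s 0 j)) = 1 - \sum_j g j * s 0 j.
    by rewrite /eta divfK// gt_eqF.
  by have := mulr_ge0 (ltW eta0) S0; lra.
move=> eta0.
pose good (a b : R) (h : R) e := let m0 := (q0 + e) / (p0 + e) in
  let m1 := (q1 + e) / (p1 + e) in let m2 := (q2 + e) / (p2 + e) in
  let m3 := (q3 + e) / (p3 + e) in
  [/\ 0 < x + m0 * y, 0 < 1 - x + m1 * y, 0 < 1 - x + m2 * (1 - y) &
      0 < x + m3 * (1 - y)] /\
  [/\ 0 <= (h + eta) * (x + m0 * y) + (a + m0 * b),
      0 <= (h + eta) * (1 - x + m1 * y) + (- a + m1 * b),
      0 <= (h + eta) * (1 - x + m2 * (1 - y)) + (- a + m2 * - b) &
      0 <= (h + eta) * (x + m3 * (1 - y)) + (a + m3 * - b)].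
have goodP a b h :
    0 <= h * (p0 * x + q0 * y) + (p0 * a + q0 * b) ->
    0 <= h * (p1 * (1 - x) + q1 * y) + (p1 * - a + q1 * b) ->
    0 <= h * (p2 * (1 - x) + q2 * (1 - y)) + (p2 * - a + q2 * - b) ->
    0 <= h * (p3 * x + q3 * (1 - y)) + (p3 * a + q3 * - b) ->
    exists2 e, 0 < e & forall z, 0 < z <= e -> good a b h z.
  move=> h0 h1 h2 h3.
  have [e0 e00 k0] := corner_perturb p00 q00 f0 h0 eta0.
  have [e1 e10 k1] := corner_perturb p10 q10 f1 h1 eta0.
  have [e2 e20 k2] := corner_perturb p20 q20 f2 h2 eta0.
  have [e3 e30 k3] := corner_perturb p30 q30 f3 h3 eta0.
  exists (Order.min (Order.min e0 e1) (Order.min e2 e3)) => [|z].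
    by rewrite !lt_min e00 e10 e20.
  rewrite !le_min => /andP[z0 /andP[/andP[z1 z2] /andP[z3 z4]]].
  have [] := k0 z; first by rewrite z0.
  have [] := k1 z; first by rewrite z0.
  have [] := k2 z; first by rewrite z0.
  by have [] := k3 z; first by rewrite z0.
(* The index [None] records that [f] stays interior under the same perturbation. *)
have [|e e0 eP] := @uniform_small R (option 'I_k) (fun o e =>
    if o is Some j then 0 < s 0 j -> good (dx j) (dy j) (g j) e else good 0 0 0 e).
  case=> [j|]; last by apply: goodP; rewrite ?oppr0 ?mulr0 ?mul0r ?addr0.
  have [/hg[_ [h0 h1 h2 h3]]|nsj] := ltP 0 (s 0 j).
    by have [e e0 eP] := goodP _ _ _ h0 h1 h2 h3; exists e => // z /eP.
  by exists 1 => // z _; rewrite ltNge nsj.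
have mp (p q : R) : 0 <= p -> 0 <= q -> 0 < (q + e) / (p + e).
  by move=> ? ?; rewrite divr_gt0 ?ltr_wpDl.
have [[F0 F1 F2 F3] _] := eP None _ (ltac:(by rewrite e0 lexx) : 0 < e <= e).
have [_ /(_ (quad F ((q0 + e) / (p0 + e)) ((q1 + e) / (p1 + e))
   ((q2 + e) / (p2 + e)) ((q3 + e) / (p3 + e))))] := sQ.
move=> /(_ (quadrilateral_quad F (mp _ _ p00 q00) (mp _ _ p10 q10) (mp _ _ p20 q20) (mp _ _ p30 q30))).
move=> /(_ (quad_maximal F (mp _ _ p00 q00) (mp _ _ p10 q10) (mp _ _ p20 q20) (mp _ _ p30 q30))).
move=> /(_ (quad_interior F0 F1 F2 F3)) /le_trans; apply.
apply: ler_sum => j _; have := s0 j; rewrite le_eqVlt => /predU1P[<-|sj].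
  by rewrite !mulr0.
rewrite ler_pM2r//; have [g0 _] := hg j sj.
have [_ [G0 G1 G2 G3]] := eP (Some j) _ (ltac:(by rewrite e0 lexx) : 0 < e <= e) sj.
apply: psi_quad_le => //; first by rewrite addr_ge0// ltW.
- by rewrite -mulrN.
- by rewrite -mulrN.
Qed.

End cut.

(** * The pinwheel triangle *)

Lemma addV_ge4 (R : realFieldType) (x y : R) :
  0 < x -> 0 < y -> x + y <= 1 -> 4 <= x^-1 + y^-1.
Proof.
move=> x0 y0 xy1; rewrite -[_^-1]mul1r -[y^-1]mul1r addf_div ?gt_eqF//.
rewrite ler_pdivlMr ?mulr_gt0//.
have := sqr_ge0 (x - y); have : 0 <= (x + y) * (1 - (x + y)) by rewrite mulr_ge0//; lra.
nra.
Qed.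

(** The point lies beyond one side of the unit triangle. If [u1 > 0], the sum of the u_i / Q_i is at
    least 4 u1 + (1 - u1) (1 / e2 + 1 / (1 - e2)) >= 4, by [s3] and 1 / Q_2 >= 1 / e2; subtracting
    the sum 2 of the u_i gives the claim. If [u1 <= 0], the first term is dropped. *)
Lemma medial_bound_gt1 (R : realFieldType) (e1 e2 e3 u1 u2 u3 w1 w2 w3 : R) :
  0 <= e1 < 1 -> 0 <= e2 < 1 -> 0 <= e3 < 1 -> u1 + u2 + u3 = 2 ->
  e1 * (1 - u2) < u1 -> e2 * (1 - u3) < u2 -> e3 * (1 - u1) < u3 ->
  0 <= w1 -> 0 <= w2 -> 0 <= w3 ->
  u1 * (1 - e1 * (1 - e3)) <= e1 * (1 - e3) * w1 ->
  u2 * (1 - e2 * (1 - e1)) <= e2 * (1 - e1) * w2 ->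
  u3 * (1 - e3 * (1 - e2)) <= e3 * (1 - e2) * w3 ->
  1 < u2 -> 2 <= w1 + w2 + w3.
Proof.
move=> /andP[e10 e11] /andP[e20 e21] /andP[e30 e31] su s1 s2 s3 w10 w20 w30.
have quot (u Q w : R) : 0 <= Q -> 0 < u -> u * (1 - Q) <= Q * w ->
    0 < Q /\ u / Q <= w + u.
  rewrite le_eqVlt => /predU1P[<-|Q0] u0 h; first by move: h; nra.
  by split => //; rewrite ler_pdivrMr//; nra.
move=> h1 h2 h3 u21.
have u11 : u1 <= 1 by rewrite leNgt; apply/negP => ?; nra.
have u30 : 0 < u3 by rewrite (le_lt_trans _ s3)// mulr_ge0// subr_ge0.
have [Q20 k2] := quot _ _ _ (mulr_ge0 e20 (ltW (ltac:(lra) : 0 < 1 - e1))) (lt_trans ltr01 u21) h2.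
have [Q30 k3] := quot _ _ _ (mulr_ge0 e30 (ltW (ltac:(lra) : 0 < 1 - e2))) u30 h3.
have e2p : 0 < e2 by rewrite lt_neqAle e20 andbT eq_sym; apply/eqP => e2e; move: Q20; rewrite e2e mul0r ltxx.
have e3p : 0 < e3 by rewrite lt_neqAle e30 andbT eq_sym; apply/eqP => e3e; move: Q30; rewrite e3e mul0r ltxx.
have e2' : 0 < 1 - e2 by lra.
have l3 : (1 - u1) / (1 - e2) <= u3 / (e3 * (1 - e2)).
  by rewrite invfM mulrA ler_pM2r ?invr_gt0// ler_pdivlMr// mulrC ltW.
have i2 : e2^-1 <= (e2 * (1 - e1))^-1.
  by rewrite lef_pV2 ?posrE//; nra.
have hm := addV_ge4 e2p e2' (ltac:(lra) : e2 + (1 - e2) <= 1).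
have [u10|u10] := leP u1 0.
  have j : 1 <= (1 - e2)^-1 by rewrite invf_ge1//; lra.
  have : e2^-1 <= u2 / (e2 * (1 - e1)).
    by rewrite (le_trans i2)// ler_peMl ?invr_ge0 ?(ltW Q20)// ltW.
  have : (1 - e2)^-1 - u1 <= (1 - u1) / (1 - e2) by nra.
  lra.
have [Q10 k1] := quot _ _ _ (mulr_ge0 e10 (ltW (ltac:(lra) : 0 < 1 - e3))) u10 h1.
have hQ : 4 <= (e1 * (1 - e3))^-1 + (e2 * (1 - e1))^-1.
  apply: addV_ge4 => //.
  have : 0 <= e1 * e3 by rewrite mulr_ge0.
  have : 0 <= (1 - e1) * (1 - e2) by rewrite mulr_ge0//; lra.
  lra.
move: k1 k2 l3 hQ i2 hm; set A := (e1 * _)^-1; set B := (e2 * (1 - e1))^-1.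
set C := e2^-1; set D := (1 - e2)^-1 => k1 k2 l3 hQ i2 hm.
have : (u2 - u1) * B >= (1 - u1) * C.
  have B0 : 0 <= B by rewrite invr_ge0 ltW.
  nra.
have p1 := mulr_ge0 (ltW u10) (ltac:(lra) : 0 <= A + B - 4).
have p2 := mulr_ge0 (ltac:(lra) : 0 <= 1 - u1) (ltac:(lra) : 0 <= C + D - 4).
lra.
Qed.

(* For every point of the triangle u_i > e_i (1 - u_(i+1)) in coordinates with
   u1 + u2 + u3 = 2, the positive ones among the u_i (1 / Q_i - 1), where
   Q_i = e_i (1 - e_(i-1)), add up to at least 2.  On the hexagon u_i >= 0 this
   sum is linear and at least 2 at all vertices. *)
Lemma medial_bound (R : realFieldType) (e1 e2 e3 u1 u2 u3 w1 w2 w3 : R) :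
  0 <= e1 < 1 -> 0 <= e2 < 1 -> 0 <= e3 < 1 -> u1 + u2 + u3 = 2 ->
  e1 * (1 - u2) < u1 -> e2 * (1 - u3) < u2 -> e3 * (1 - u1) < u3 ->
  0 <= w1 -> 0 <= w2 -> 0 <= w3 ->
  u1 * (1 - e1 * (1 - e3)) <= e1 * (1 - e3) * w1 ->
  u2 * (1 - e2 * (1 - e1)) <= e2 * (1 - e1) * w2 ->
  u3 * (1 - e3 * (1 - e2)) <= e3 * (1 - e2) * w3 ->
  2 <= w1 + w2 + w3.
Proof.
move=> he1 he2 he3 su s1 s2 s3 w10 w20 w30 h1 h2 h3.
have [u1l|u1g] := leP u1 1; last first.
  rewrite (_ : w1 + w2 + w3 = w3 + w1 + w2); last ring.
  by apply: (@medial_bound_gt1 _ e3 e1 e2 u3 u1 u2) => //; rewrite -su; ring.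
have [u2l|u2g] := leP u2 1; last exact: medial_bound_gt1 su s1 s2 s3 w10 w20 w30 h1 h2 h3 u2g.
have [u3l|u3g] := leP u3 1; last first.
  rewrite (_ : w1 + w2 + w3 = w2 + w3 + w1); last ring.
  by apply: (@medial_bound_gt1 _ e2 e3 e1 u2 u3 u1) => //; rewrite -su; ring.
have /andP[e10 e11] := he1; have /andP[e20 e21] := he2; have /andP[e30 e31] := he3.
have pos (e e' u v w : R) : 0 <= e -> v <= 1 -> e' < 1 -> e * (1 - v) < u -> 
    u * (1 - e * (1 - e')) <= e * (1 - e') * w ->
    0 < e * (1 - e') /\ u / (e * (1 - e')) <= w + u.
  move=> e0 v1 e'1 s h.
  have u0 : 0 < u by rewrite (le_lt_trans _ s)// mulr_ge0// subr_ge0.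
  have : 0 <= e * (1 - e') by rewrite mulr_ge0//; lra.
  rewrite le_eqVlt => /predU1P[q|Q0]; first by move: h; rewrite -q; nra.
  by split => //; rewrite ler_pdivrMr//; nra.
have [Q1 k1] := pos _ _ _ _ _ e10 u2l e31 s1 h1.
have [Q2 k2] := pos _ _ _ _ _ e20 u3l e11 s2 h2.
have [Q3 k3] := pos _ _ _ _ _ e30 u1l e21 s3 h3.
have le1 (x y z : R) : 0 <= x -> x < 1 -> y < 1 -> 0 <= z ->
    x * (1 - z) + y * (1 - x) <= 1.
  move=> x0 x1 y1 z0; have := mulr_ge0 x0 z0.
  have : 0 <= (1 - x) * (1 - y) by rewrite mulr_ge0//; lra.
  lra.
have b1 : 4 <= (e1 * (1 - e3))^-1 + (e2 * (1 - e1))^-1 by apply: addV_ge4 => //; exact: le1.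
have b2 : 4 <= (e2 * (1 - e1))^-1 + (e3 * (1 - e2))^-1 by apply: addV_ge4 => //; exact: le1.
have b3 : 4 <= (e3 * (1 - e2))^-1 + (e1 * (1 - e3))^-1 by apply: addV_ge4 => //; exact: le1.
move: k1 k2 k3 b1 b2 b3; set A := (e1 * _)^-1; set B := (e2 * _)^-1.
set C := (e3 * _)^-1 => k1 k2 k3 b1 b2 b3.
(* In the unit triangle the numbers 1 - u_i are nonnegative with sum 1; as weights they combine the
   pairwise bounds into u1 A + u2 B + u3 C >= 4. *)
have p1 := mulr_ge0 (ltac:(lra) : 0 <= 1 - u3) (ltac:(lra) : 0 <= A + B - 4).
have p2 := mulr_ge0 (ltac:(lra) : 0 <= 1 - u1) (ltac:(lra) : 0 <= B + C - 4).
have p3 := mulr_ge0 (ltac:(lra) : 0 <= 1 - u2) (ltac:(lra) : 0 <= C + A - 4).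
have E3 : u3 = 2 - u1 - u2 by rewrite -su; ring.
move: p1 p2 p3 k1 k2 k3; rewrite E3 => p1 p2 p3 k1 k2 k3.
have : (2 - u1 - u2) * C + u1 * A + u2 * B >= 4 by lra.
lra.
Qed.

Section rotate.
Context {R : realType}.
Implicit Types F : frame R.

Lemma rotF_subproof F : Z2 (- fu F - fv F) /\ (1 - fcu F - fcv F) \is a Num.int /\
  (fv F 0 0 * (- fu F - fv F) 0 1 - fv F 0 1 * (- fu F - fv F) 0 0) ^+ 2 = 1.
Proof.
split; first by move=> i; rewrite !mxE rpredB ?rpredN//; [apply: fu_int|apply: fv_int].
split; first by rewrite !rpredB ?rpred1 ?fcu_int ?fcv_int.
by rewrite !mxE -[RHS](fdet F); ring.
Qed.

(* The affine automorphism of the lattice permuting the corners (0,0), (1,0),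
   (0,1) of the unit triangle cyclically. *)
Definition rotF F := Frame (@fv_int _ F) (@fcv_int _ F)
  (proj1 (rotF_subproof F)) (proj1 (proj2 (rotF_subproof F)))
  (proj2 (proj2 (rotF_subproof F))).

Lemma cX_rotF F p : cX (rotF F) p = cY F p.
Proof. by []. Qed.

Lemma cY_rotF F p : cY (rotF F) p = 1 - cX F p - cY F p.
Proof. by rewrite /cX /cY /= dotDl !dotNl; ring. Qed.

End rotate.

Section pinwheel.
Context {R : realType} (k : nat) (f : 'rV[R]_2) (r : 'I_k -> 'rV[R]_2).
Hypothesis r0 : forall j, r j <> 0.
Variable s : 'rV[R]_k.
Hypothesis sQ : quadrilateral_closure f r s.
Implicit Types (F : frame R).

(** The limit in which the sides through (1,0) and (1,1) both become the line X = 1. Raising [gam]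
    to [g] moves the points f + r_j / g_j towards [f], so the two other sides need no new check. *)
Lemma triangle_cut F (A B C E : R) (gam g : 'I_k -> R) :
  let X := cX F f in let Y := cY F f in
  let dX j := dot (fu F) (r j) in let dY j := dot (fv F) (r j) in
  0 <= A -> 0 <= B -> 0 <= C -> 0 <= E ->
  0 < A * X + B * Y -> 0 < C * X + E * (1 - Y) -> 0 < 1 - X ->
  (forall j, 0 < s 0 j -> [/\ 0 <= gam j,
     0 <= gam j * (A * X + B * Y) + (A * dX j + B * dY j) &
     0 <= gam j * (C * X + E * (1 - Y)) + (C * dX j - E * dY j)]) ->
  (forall j, 0 < s 0 j -> gam j <= g j /\ 0 <= g j * (1 - X) - dX j) ->
  1 <= \sum_j g j * s 0 j.
Proof.
move=> X Y dX dY A0 B0 C0 E0 S1 S3 U2 hgam hg.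
apply: (quad_cut r0 sQ (F := F) (p0 := A) (q0 := B) (p1 := 1) (q1 := 0)
  (p2 := 1) (q2 := 0) (p3 := C) (q3 := E)) => //.
- by rewrite mul1r mul0r addr0.
- by rewrite mul1r mul0r addr0.
move=> j sj; have [gam0 h1 h3] := hgam j sj; have [gg h2] := hg j sj.
rewrite -/X -/Y -/(dX j) -/(dY j); split; first exact: le_trans gam0 gg.
have gg0 : 0 <= g j - gam j by rewrite subr_ge0.
split; [|lra|lra|].
- have := mulr_ge0 gg0 (ltW S1); lra.
- have := mulr_ge0 gg0 (ltW S3); lra.
Qed.

(** The cut is applied to [gam j + q / (1 - q) / u * Ri j], which the last hypothesis makes
    admissible, and is then solved for [u] to fit [medial_bound]. For [u <= 0] no cut is available,
    but the claim is trivial. *)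
Lemma replaced_side_cut (gam du Ri : 'I_k -> R) (u q : R) :
  let G := \sum_j gam j * s 0 j in
  G < 1 -> 0 <= q < 1 -> (forall j, 0 < s 0 j -> 0 <= Ri j) ->
  (forall g, 0 < u -> (forall j, 0 < s 0 j -> gam j <= g j /\ 0 <= g j * u + du j) ->
     1 <= \sum_j g j * s 0 j) ->
  (forall j, 0 < s 0 j -> 0 <= (1 - q) * (gam j * u + du j) + q * Ri j) ->
  0 <= (\sum_j Ri j * s 0 j) / (1 - G) /\
  u * (1 - q) <= q * ((\sum_j Ri j * s 0 j) / (1 - G)).
Proof.
move=> G; rewrite -subr_gt0 => G1 /andP[q0 q1] R0 cut hu.
have s0 j : 0 <= s 0 j by have [h _] := sQ; exact: h.
set S := \sum_j Ri j * s 0 j.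
have SS : 0 <= S.
  apply: sumr_ge0 => j _; have := s0 j; rewrite le_eqVlt => /predU1P[<-|sj].
    by rewrite mulr0.
  by rewrite mulr_ge0 ?R0.
have S0 : 0 <= S / (1 - G) by rewrite divr_ge0// ltW.
split=> //; have q1' : 0 < 1 - q by rewrite subr_gt0.
have [u0|u0] := leP u 0.
  have := mulr_ge0 q0 S0; have : u * (1 - q) <= 0 by rewrite mulr_le0_ge0// ltW.
  lra.
have q1n : 1 - q != 0 by rewrite gt_eqF.
have un : u != 0 by rewrite gt_eqF.
have := cut (fun j => gam j + q / (1 - q) / u * Ri j) u0.
rewrite (_ : \sum_j _ = G + q / (1 - q) / u * S); last first.
  by rewrite mulr_sumr -big_split; apply: eq_bigr => j _; rewrite mulrDl mulrA.
move=> h; have {}h : 1 <= G + q / (1 - q) / u * S.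
  apply: h => j sj; split.
    by rewrite lerDl mulr_ge0 ?R0// !divr_ge0// ltW.
  rewrite (_ : (gam j + q / (1 - q) / u * Ri j) * u + du j =
    ((1 - q) * (gam j * u + du j) + q * Ri j) / (1 - q)).
    by rewrite divr_ge0 ?hu// ltW.
  by field; rewrite q1n un.
rewrite mulrA ler_pdivlMr//.
have {}h : (1 - G) * (u * (1 - q)) <= q / (1 - q) / u * S * (u * (1 - q)).
  by rewrite ler_pM2r ?mulr_gt0//; lra.
rewrite mulrC (le_trans h)// le_eqVlt; apply/orP; left; apply/eqP.
by field; rewrite q1n un.
Qed.

(** [U] is meant as the slack of a ray at the side put in, and [H], [H'], [H''] as its slacks at the
    sides of the triangle. The linear relation between them gives a nonpositive coefficient only to
    [H'], which is what the added multiple of [H'] compensates. *)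
Lemma side_slack_ge0 (U H H' H'' e e' e'' N : R) : 0 < N ->
  0 <= e -> e' < 1 -> e'' < 1 -> e * (1 - e'') < 1 -> 0 <= H -> 0 <= H'' ->
  N * U + e * (1 - e'') * H' = e * H'' + (1 + (1 - e'') * (1 - e')) * H ->
  0 <= (1 - e * (1 - e'')) * U + e * (1 - e'') * (H' * (1 - e * (1 - e'')) / N).
Proof.
move=> N0 e0 e'1 e''1 q1 H0 H''0 NE; have Nn : N != 0 by rewrite gt_eqF.
rewrite (_ : _ + _ = (1 - e * (1 - e'')) * (N * U + e * (1 - e'') * H') / N); last by field.
rewrite divr_ge0 ?(ltW N0)// mulr_ge0 ?subr_ge0 ?(ltW q1)// NE addr_ge0 ?mulr_ge0//.
by rewrite addr_ge0// mulr_ge0// subr_ge0 ltW.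
Qed.

(* The forms u1 = X + Y, u2 = 1 - X and u3 = 1 - Y vanish on the parallels to
   the sides of the unit triangle through the opposite corners, and add up to 2.
   In these coordinates the three sides are u_i = e_i (1 - u_(i+1)).  Replacing
   the i-th side by u_i = 0 gives a limit of quadrilaterals, whose gauge exceeds
   that of the triangle by at most a multiple of the barycentric coordinate
   [R_i] of the vertex cut off. *)
Lemma pinwheel_cut F (A B P Q C E : R) (gam : 'I_k -> R) :
  let X := cX F f in let Y := cY F f in
  let dX j := dot (fu F) (r j) in let dY j := dot (fv F) (r j) in
  0 < A <= B -> 0 <= Q < P -> 0 <= C -> 0 < E ->
  0 < A * X + B * Y -> 0 < P * (1 - X) - Q * Y -> 0 < C * X + E * (1 - Y) ->
  (forall j, 0 < s 0 j -> 0 <= gam j /\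
    [/\ 0 <= gam j * (A * X + B * Y) + (A * dX j + B * dY j),
     0 <= gam j * (P * (1 - X) - Q * Y) + (- P * dX j - Q * dY j) &
     0 <= gam j * (C * X + E * (1 - Y)) + (C * dX j - E * dY j)]) ->
  2 / 3 <= \sum_j gam j * s 0 j.
Proof.
move=> X Y dX dY /andP[A0 AB] /andP[Q0 QP] C0 E0 S1 S2 S3 hgam.
have s0 j : 0 <= s 0 j by have [h _] := sQ; exact: h.
set G := \sum_j _; rewrite leNgt; apply/negP => G23.
have B0 : 0 < B by exact: lt_le_trans A0 AB.
have P0 : 0 < P by exact: le_lt_trans Q0 QP.
have CE0 : 0 < C + E by rewrite ltr_wpDl.
have Bn : B != 0 by rewrite gt_eqF.
have Pn : P != 0 by rewrite gt_eqF.
have CEn : C + E != 0 by rewrite gt_eqF.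
have cut1 g : 0 < X + Y ->
    (forall j, 0 < s 0 j -> gam j <= g j /\ 0 <= g j * (X + Y) + (dX j + dY j)) ->
    1 <= \sum_j g j * s 0 j.
  move=> u1 hg; apply: (@triangle_cut (rotF (rotF F)) E (C + E) Q (P - Q) gam g);
    rewrite ?(cX_rotF, cY_rotF) -/X -/Y; try lra.
    move=> j sj; have [? [? ? ?]] := hgam j sj.
    by rewrite /= !dotDl !dotNl !dotDl !dotNl -/(dX j) -/(dY j); split; lra.
  move=> j sj; have [? ?] := hg j sj.
  by rewrite /= !dotDl !dotNl -/(dX j) -/(dY j); split; lra.
have cut2 g : 0 < 1 - X ->
    (forall j, 0 < s 0 j -> gam j <= g j /\ 0 <= g j * (1 - X) - dX j) ->
    1 <= \sum_j g j * s 0 j.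
  move=> u2 hg; apply: (@triangle_cut F A B C E gam g) => //; try lra.
  by move=> j sj; have [? [? ? ?]] := hgam j sj.
have cut3 g : 0 < 1 - Y ->
    (forall j, 0 < s 0 j -> gam j <= g j /\ 0 <= g j * (1 - Y) - dY j) ->
    1 <= \sum_j g j * s 0 j.
  move=> u3 hg; apply: (@triangle_cut (rotF F) (P - Q) P (B - A) A gam g);
    rewrite ?(cX_rotF, cY_rotF) -/X -/Y; try lra.
    move=> j sj; have [? [? ? ?]] := hgam j sj.
    by rewrite /= !dotDl !dotNl -/(dX j) -/(dY j); split; lra.
  by move=> j sj; have [? ?] := hg j sj; split.
pose e1 := (B - A) / B; pose e2 := Q / P; pose e3 := C / (C + E).
have he1 : 0 <= e1 < 1 by rewrite divr_ge0 ?subr_ge0 ?(ltW B0)//= ltr_pdivrMr//; lra.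
have he2 : 0 <= e2 < 1 by rewrite divr_ge0 ?(ltW P0)//= ltr_pdivrMr//; lra.
have he3 : 0 <= e3 < 1 by rewrite divr_ge0 ?(ltW CE0)//= ltr_pdivrMr//; lra.
have /andP[e10 e11] := he1; have /andP[e20 e21] := he2; have /andP[e30 e31] := he3.
have E1 (x y : R) : x + y - e1 * x = (A * x + B * y) / B by rewrite /e1; field.
have E2 (x y : R) : x - e2 * y = (P * x - Q * y) / P by rewrite /e2; field.
have E3 (x y : R) : (1 - e3) * y + e3 * x = (C * x + E * y) / (C + E).
  by rewrite /e3; field.
clearbody e1 e2 e3.
pose Q1 := e1 * (1 - e3); pose Q2 := e2 * (1 - e1); pose Q3 := e3 * (1 - e2).
have Q01 (a b : R) : 0 <= a -> a < 1 -> 0 <= b -> b < 1 -> 0 <= a * (1 - b) < 1.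
  move=> a0 a1 b0 b1; have := mulr_ge0 a0 b0.
  have := mulr_ge0 a0 (ltac:(lra) : 0 <= 1 - b); lra.
have hQ1 := Q01 _ _ e10 e11 e30 e31; have /andP[Q10 Q11] := hQ1.
have hQ2 := Q01 _ _ e20 e21 e10 e11; have /andP[Q20 Q21] := hQ2.
have hQ3 := Q01 _ _ e30 e31 e20 e21; have /andP[Q30 Q31] := hQ3.
pose N := 1 + (1 - e1) * (1 - e2) * (1 - e3).
have N0 : 0 < N.
  by rewrite addr_gt0// !mulr_gt0 ?subr_gt0.
have Nn : N != 0 by rewrite gt_eqF.
pose H1 j := gam j * (X + Y - e1 * X) + (dX j + dY j - e1 * dX j).
pose H2 j := gam j * ((1 - X) - e2 * Y) + (- dX j - e2 * dY j).
pose H3 j := gam j * ((1 - e3) * (1 - Y) + e3 * X) + ((1 - e3) * - dY j + e3 * dX j).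
have Hge j : 0 < s 0 j -> [/\ 0 <= H1 j, 0 <= H2 j & 0 <= H3 j].
  move=> sj; have [g0 [h1 h2 h3]] := hgam j sj.
  rewrite /H1 /H2 /H3 !E1 !E2 !E3 !(mulrA (gam j)) -!mulrDl.
  by split; apply: divr_ge0; rewrite ?(ltW B0) ?(ltW P0) ?(ltW CE0)//; lra.
pose R1 j := H2 j * (1 - Q1) / N; pose R2 j := H3 j * (1 - Q2) / N.
pose R3 j := H1 j * (1 - Q3) / N.
have Rge (h q : R) : 0 <= h -> q < 1 -> 0 <= h * (1 - q) / N.
  by move=> h0 q1; rewrite divr_ge0 ?mulr_ge0 ?(ltW N0)//; lra.
have Rsum j : R1 j + R2 j + R3 j = gam j.
  rewrite /R1 /R2 /R3 -!mulrDl.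
  apply: (mulIf Nn); rewrite divfK// /H1 /H2 /H3 /Q1 /Q2 /Q3 /N; ring.
have G1 : G < 1 by clear -G23; lra.
have w1 : 0 <= (\sum_j R1 j * s 0 j) / (1 - G) /\
    (X + Y) * (1 - Q1) <= Q1 * ((\sum_j R1 j * s 0 j) / (1 - G)).
  apply: (@replaced_side_cut gam (fun j => dX j + dY j)) => // [j|j] /Hge[h1 h2 h3].
    exact: Rge.
  by apply: side_slack_ge0 e21 e31 Q11 h1 h3 _ => //; rewrite /H1 /H2 /H3 /N; ring.
have w2 : 0 <= (\sum_j R2 j * s 0 j) / (1 - G) /\
    (1 - X) * (1 - Q2) <= Q2 * ((\sum_j R2 j * s 0 j) / (1 - G)).
  apply: (@replaced_side_cut gam (fun j => - dX j)) => // [j|j] /Hge[h1 h2 h3].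
    exact: Rge.
  by apply: side_slack_ge0 e31 e11 Q21 h2 h1 _ => //; rewrite /H1 /H2 /H3 /N; ring.
have w3 : 0 <= (\sum_j R3 j * s 0 j) / (1 - G) /\
    (1 - Y) * (1 - Q3) <= Q3 * ((\sum_j R3 j * s 0 j) / (1 - G)).
  apply: (@replaced_side_cut gam (fun j => - dY j)) => // [j|j] /Hge[h1 h2 h3].
    exact: Rge.
  by apply: side_slack_ge0 e11 e21 Q31 h3 h2 _ => //; rewrite /H1 /H2 /H3 /N; ring.
have s1 : e1 * (1 - (1 - X)) < X + Y.
  rewrite -subr_gt0 [X in 0 < X](_ : _ = X + Y - e1 * X); last ring.
  by rewrite E1 divr_gt0.
have s2 : e2 * (1 - (1 - Y)) < 1 - X.
  rewrite -subr_gt0 [X in 0 < X](_ : _ = 1 - X - e2 * Y); last ring.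
  by rewrite E2 divr_gt0.
have s3 : e3 * (1 - (X + Y)) < 1 - Y.
  rewrite -subr_gt0 [X in 0 < X](_ : _ = (1 - e3) * (1 - Y) + e3 * X); last ring.
  by rewrite E3 divr_gt0.
have su : X + Y + (1 - X) + (1 - Y) = 2 by ring.
(* By [Rsum] the three sums add up to [G / (1 - G)], and this being at least 2 contradicts
   [G < 2 / 3]. *)
have := medial_bound he1 he2 he3 su s1 s2 s3 w1.1 w2.1 w3.1 w1.2 w2.2 w3.2.
rewrite -!mulrDl -!big_split /= (eq_bigr (fun j => gam j * s 0 j)) => [|j _].
  rewrite -/G ler_pdivlMr ?subr_gt0//; clear -G23; lra.
by rewrite -(Rsum j) !mulrDl.
Qed.

End pinwheel.

(** * Covering the lattice by half-planes *)

Notation vecz := (int * int)%type.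

Definition dz (n y : vecz) : int := n.1 * y.1 + n.2 * y.2.
Definition detz (a b : vecz) : int := a.1 * b.2 - a.2 * b.1.

Lemma dzD n y z : dz n (y + z) = dz n y + dz n z.
Proof. rewrite /dz /=; ring. Qed.

Lemma dzN n y : dz n (- y) = - dz n y.
Proof. rewrite /dz /=; ring. Qed.

Definition scz (k : int) (y : vecz) : vecz := (k * y.1, k * y.2).

Lemma dzZ n k y : dz n (scz k y) = k * dz n y.
Proof. rewrite /dz /=; ring. Qed.

Lemma vecz_eq (a b : vecz) : a.1 = b.1 -> a.2 = b.2 -> a = b.
Proof. by case: a b => [? ?] [? ?] /= -> ->. Qed.

(** Reducing the Cramer coordinates of any [w] modulo D gives a lattice point of the parallelogram;
    it or its reflection lies in the triangle, so the residues vanish. For the two unit vectors this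
    makes D divide all entries of the matrix, so D^2 divides D. *)
Lemma empty_triangle_det_gt0 (e1 e2 : vecz) : 0 < detz e1 e2 ->
  (forall (w : vecz) (a b : int), scz (detz e1 e2) w = scz a e1 + scz b e2 ->
     0 <= a -> 0 <= b -> a + b <= detz e1 e2 -> a < detz e1 e2 -> b < detz e1 e2 ->
     a = 0 /\ b = 0) ->
  detz e1 e2 = 1.
Proof.
set D := detz e1 e2 => D0 h.
have dvd (w : vecz) : (detz w e2 %% D)%Z = 0 /\ (detz e1 w %% D)%Z = 0.
  set a := detz w e2; set b := detz e1 w.
  have wE : scz D w = scz a e1 + scz b e2.
    by apply: vecz_eq; rewrite /= /a /b /D /detz; ring.
  have Dn : D != 0 by rewrite gt_eqF.
  have ra0 := modz_ge0 a Dn; have rb0 := modz_ge0 b Dn.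
  have ra1 := ltz_pmod a D0; have rb1 := ltz_pmod b D0.
  have ea := divz_eq a D; have eb := divz_eq b D.
  set ra := (a %% D)%Z in ra0 ra1 ea *; set rb := (b %% D)%Z in rb0 rb1 eb *.
  have [w1 w2] : D * w.1 = a * e1.1 + b * e2.1 /\ D * w.2 = a * e1.2 + b * e2.2.
    by case: wE.
  set qa := (a %/ D)%Z in ea; set qb := (b %/ D)%Z in eb.
  rewrite ea eb in w1 w2.
  pose w' := w - scz qa e1 - scz qb e2.
  have [w1' w2'] : D * w'.1 = ra * e1.1 + rb * e2.1 /\ D * w'.2 = ra * e1.2 + rb * e2.2.
    by rewrite /w' /= !mulrBr w1 w2; split; ring.
  have [lt|gt] := leP (ra + rb) D.
    by apply: (h w') => //; apply: vecz_eq; rewrite /= ?w1' ?w2'.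
  have [] := h (e1 + e2 - w') (D - ra) (D - rb); [|lia..].
  by apply: vecz_eq; rewrite /= mulrBr ?w1' ?w2'; ring.
have dv x : (x %% D)%Z = 0 -> exists y, x = y * D.
  by move=> x0; exists (x %/ D)%Z; rewrite {1}(divz_eq x D) x0 addr0.
have [/dv[p pE] /dv[q qE]] := dvd (1, 0); have [/dv[u uE] /dv[v vE]] := dvd (0, 1).
have : D * 1 = D * (D * (p * v - q * u)).
  by rewrite {1}/D /detz; move: pE qE uE vE; rewrite /detz /=; nia.
have Dn : D != 0 by rewrite gt_eqF.
move/(mulfI Dn); move: (p * v - q * u) => X; have [X0|X1] := leP X 0; nia.
Qed.

Lemma empty_triangle_det (e1 e2 : vecz) : detz e1 e2 != 0 ->
  (forall (w : vecz) (a b d : int), 0 < d -> scz d w = scz a e1 + scz b e2 ->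
     0 <= a -> 0 <= b -> a + b <= d -> a < d -> b < d -> a = 0 /\ b = 0) ->
  detz e1 e2 ^+ 2 = 1.
Proof.
move=> Dn h; have [D0|D0] := ltP 0 (detz e1 e2).
  by rewrite empty_triangle_det_gt0// => w a b; apply: h.
have swap : detz e1 e2 = - detz e2 e1 by rewrite /detz; ring.
have D0' : 0 < detz e2 e1 by lia.
rewrite swap sqrrN empty_triangle_det_gt0// => w a b E a0 b0 ab aD bD.
by have [] := h w b a _ D0'; rewrite 1?addrC//; lia.
Qed.

(** * Configurations of two, three and four half-planes *)

Section outcome.
(* [Good n b] is meant to say that the half-plane of the [z] with [b <= dz n z]
   misses the convex set under consideration. *)
Variable Good : vecz -> int -> Prop.

(** Half-planes through the corners of a unimodular parallelogram, which lies weakly on the other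
    side of each. The signs are those required by [quad_cut], so degenerate sides are allowed. *)
Definition quad_outcome := exists o e1 e2 n0 n1 n2 n3 : vecz,
  [/\ detz e1 e2 ^+ 2 = 1,
      [/\ Good n0 (dz n0 o), Good n1 (dz n1 (o + e1)),
          Good n2 (dz n2 (o + e1 + e2)) & Good n3 (dz n3 (o + e2))],
      [/\ dz n0 e1 <= 0, 0 <= dz n1 e1, 0 <= dz n2 e1 & dz n3 e1 <= 0] &
      [/\ dz n0 e2 <= 0, dz n1 e2 <= 0, 0 <= dz n2 e2 & 0 <= dz n3 e2]].

(** The inequalities fix one sense of rotation and match [pinwheel_cut]; exchanging [e1] and [e2]
    reduces the other sense to it. *)
Definition pinwheel_outcome := exists o e1 e2 n1 n2 n3 : vecz,
  [/\ detz e1 e2 ^+ 2 = 1,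
      [/\ Good n1 (dz n1 o), Good n2 (dz n2 (o + e1)) & Good n3 (dz n3 (o + e2))],
      [/\ dz n1 e1 < 0, 0 < dz n2 e1 & dz n3 e1 <= 0] &
      [/\ dz n1 e2 <= dz n1 e1, 0 <= dz n2 e2 < dz n2 e1 & 0 < dz n3 e2]].

(* Half-planes through the corners [o], [o + e1], [o + e2] of a unimodular
   triangle, each leaving out the two other corners. *)
Definition tri (o e1 e2 n1 n2 n3 : vecz) :=
  [/\ detz e1 e2 ^+ 2 = 1,
      [/\ Good n1 (dz n1 o), Good n2 (dz n2 (o + e1)) & Good n3 (dz n3 (o + e2))],
      [/\ dz n1 e1 < 0, 0 < dz n2 e1 & dz n3 e1 < dz n3 e2] &
      [/\ dz n1 e2 < 0, dz n2 e2 < dz n2 e1 & 0 < dz n3 e2]].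

Lemma tri_swap o e1 e2 n1 n2 n3 : tri o e1 e2 n1 n2 n3 -> tri o e2 e1 n1 n3 n2.
Proof.
case=> D [? ? ?] [? ? ?] [? ? ?]; split => //.
by rewrite -D /detz; ring.
Qed.

Lemma tri_cycle o e1 e2 n1 n2 n3 :
  tri o e1 e2 n1 n2 n3 -> tri (o + e1) (e2 - e1) (- e1) n2 n3 n1.
Proof.
case=> D [g1 g2 g3] [? ? ?] [? ? ?]; split.
- by rewrite -D /detz /=; ring.
- by rewrite addrACA subrr addr0 addrK.
- by rewrite !(dzD, dzN); split; lia.
- by rewrite !(dzD, dzN); split; lia.
Qed.

(** The second boundary also passes through [o + e1 + e2], so its half-plane serves two corners. *)
Lemma tri_quad o e1 e2 n1 n2 n3 : tri o e1 e2 n1 n2 n3 ->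
  dz n2 e2 = 0 -> dz n3 e1 <= 0 -> quad_outcome.
Proof.
case=> D [g1 g2 g3] [? ? ?] [? ? ?] h2 h3.
exists o, e1, e2, n1, n2, n2, n3; split => //; [split=> //|split; lia..].
by rewrite dzD h2 addr0.
Qed.

(** Each of the three points completing the unit triangle to a parallelogram can be covered by two
    of the half-planes only. Three different choices form a pinwheel, in either sense; a half-plane
    chosen twice is parallel to a side of the unit triangle. *)
Lemma tri_outcome o e1 e2 n1 n2 n3 : tri o e1 e2 n1 n2 n3 ->
  (forall z, [\/ dz n1 o <= dz n1 z, dz n2 (o + e1) <= dz n2 z |
                 dz n3 (o + e2) <= dz n3 z]) ->
  quad_outcome \/ pinwheel_outcome.
Proof.
move=> T cov.
have T2 := tri_cycle T; have T3 := tri_cycle T2.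
have [D [g1 g2 g3] [s1 s2 s3] [s4 s5 s6]] := T.
have c1 : 0 <= dz n2 e2 \/ 0 <= dz n3 e1.
  by case: (cov (o + e1 + e2)); rewrite !dzD; [lia|left|right]; lia.
have c2 : dz n1 e1 <= dz n1 e2 \/ dz n3 e1 <= 0.
  by case: (cov (o + e2 - e1)); rewrite !(dzD, dzN); [left|lia|right]; lia.
have c3 : dz n1 e2 <= dz n1 e1 \/ dz n2 e2 <= 0.
  by case: (cov (o + e1 - e2)); rewrite !(dzD, dzN); [left|right|lia]; lia.
case: c1 => h1; case: c2 => h2; case: c3 => h3.
- left; apply: (tri_quad T3); rewrite !(dzD, dzN); lia.
- left; apply: (tri_quad (tri_swap T3)); rewrite !(dzD, dzN); lia.
- by right; exists o, e1, e2, n1, n2, n3; split; [by []|by []|by []|split => //; apply/andP].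
- left; apply: (tri_quad T); rewrite ?(dzD, dzN); lia.
- left; apply: (tri_quad (tri_swap T2)); rewrite !(dzD, dzN); lia.
- right; exists o, e2, e1, n1, n3, n2; split; [|by []|by []|by split => //; apply/andP].
  by rewrite -D /detz; ring.
- left; apply: (tri_quad T2); rewrite !(dzD, dzN); lia.
- left; apply: (tri_quad (tri_swap T)); rewrite ?(dzD, dzN); lia.
Qed.

(** Of three collinear points one lies between the others, and no half-plane bounded there leaves
    both out. *)
Lemma tri_nondegenerate e1 e2 n1 n2 n3 :
  [/\ dz n1 e1 < 0, 0 < dz n2 e1 & dz n3 e1 < dz n3 e2] ->
  [/\ dz n1 e2 < 0, dz n2 e2 < dz n2 e1 & 0 < dz n3 e2] -> detz e1 e2 != 0.
Proof.
move=> [s1 s2 s3] [s4 s5 s6]; apply/eqP => D.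
have par n : dz n1 e2 * dz n e1 = dz n1 e1 * dz n e2.
  have : dz n1 e2 * dz n e1 - dz n1 e1 * dz n e2 =
    detz e1 e2 * (n1.2 * n.1 - n1.1 * n.2) by rewrite /dz /detz; ring.
  by rewrite D mul0r; lia.
have := par n2; have := par n3; nia.
Qed.

(** Each of the three half-planes meets the triangle in its own corner only, so the covering leaves
    no other lattice point there. [P] is the slot for a fourth half-plane. *)
Lemma det_triangle e1 e2 n1 n2 n3 (P : vecz -> Prop) :
  [/\ dz n1 e1 < 0, 0 < dz n2 e1 & dz n3 e1 < dz n3 e2] ->
  [/\ dz n1 e2 < 0, dz n2 e2 < dz n2 e1 & 0 < dz n3 e2] ->
  (forall w : vecz, [\/ 0 <= dz n1 w, dz n2 e1 <= dz n2 w, dz n3 e2 <= dz n3 w | P w]) ->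
  (forall (w : vecz) a b d, 0 < d -> scz d w = scz a e1 + scz b e2 ->
     0 <= a -> 0 <= b -> a + b <= d -> ~ P w) ->
  detz e1 e2 ^+ 2 = 1.
Proof.
move=> S1 S2 cov hP; apply: empty_triangle_det.
  exact: (@tri_nondegenerate _ _ n1 n2 n3).
move: S1 S2 => [s1 s2 s3] [s4 s5 s6] w a b d d0 wE a0 b0 ab ad bd.
have E n : d * dz n w = a * dz n e1 + b * dz n e2.
  by have := congr1 (dz n) wE; rewrite dzD !dzZ.
have := E n1; have := E n2; have := E n3.
case: (cov w) => [h|h|h|/(hP _ _ _ _ d0 wE a0 b0 ab)//] e3 e2' e1'.
- have h' : 0 <= d * dz n1 w by rewrite mulr_ge0// ltW.
  have b1 : b * dz n1 e2 <= 0 by rewrite mulr_ge0_le0// ltW.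
  have b2 : a * dz n1 e1 <= 0 by rewrite mulr_ge0_le0// ltW.
  split.
    by have /eqP : a * dz n1 e1 = 0 by [lia]; rewrite mulf_eq0 (lt_eqF s1) orbF => /eqP.
  by have /eqP : b * dz n1 e2 = 0 by [lia]; rewrite mulf_eq0 (lt_eqF s4) orbF => /eqP.
- have h' : d * dz n2 e1 <= d * dz n2 w by rewrite ler_pM2l.
  have h1 : 0 <= (d - a - b) * dz n2 e1 by rewrite mulr_ge0//; lia.
  have h2 : 0 <= b * (dz n2 e1 - dz n2 e2) by rewrite mulr_ge0//; lia.
  have h3 : 0 < (d - a) * dz n2 e1 by rewrite mulr_gt0//; lia.
  have /eqP : b * (dz n2 e1 - dz n2 e2) = 0 by lia.
  rewrite mulf_eq0 => /orP[/eqP b00|/eqP]; last lia.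
  by move: h3 h' e2'; rewrite b00; lia.
- have h' : d * dz n3 e2 <= d * dz n3 w by rewrite ler_pM2l.
  have h1 : 0 <= (d - a - b) * dz n3 e2 by rewrite mulr_ge0//; lia.
  have h2 : 0 <= a * (dz n3 e2 - dz n3 e1) by rewrite mulr_ge0//; lia.
  have h3 : 0 < (d - b) * dz n3 e2 by rewrite mulr_gt0//; lia.
  have /eqP : a * (dz n3 e2 - dz n3 e1) = 0 by lia.
  rewrite mulf_eq0 => /orP[/eqP a00|/eqP]; last lia.
  by move: h3 h' e3; rewrite a00; lia.
Qed.

(* [tri] with a fourth half-plane through [o + a e1 + b e2], each of the four
   leaving out the three other points, and together covering the lattice. *)
Definition tet (o e1 e2 : vecz) (a b : int) (n1 n2 n3 n4 : vecz) :=
  [/\ tri o e1 e2 n1 n2 n3,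
      Good n4 (dz n4 (o + scz a e1 + scz b e2)),
      [/\ a * dz n1 e1 + b * dz n1 e2 < 0,
          a * dz n2 e1 + b * dz n2 e2 < dz n2 e1 &
          a * dz n3 e1 + b * dz n3 e2 < dz n3 e2],
      [/\ 0 < a * dz n4 e1 + b * dz n4 e2,
          dz n4 e1 < a * dz n4 e1 + b * dz n4 e2 &
          dz n4 e2 < a * dz n4 e1 + b * dz n4 e2] &
      forall w : vecz, [\/ 0 <= dz n1 w, dz n2 e1 <= dz n2 w, dz n3 e2 <= dz n3 w |
                  a * dz n4 e1 + b * dz n4 e2 <= dz n4 w]].

Lemma tet_cycle o e1 e2 a b n1 n2 n3 n4 : tet o e1 e2 a b n1 n2 n3 n4 ->
  tet (o + e1) (e2 - e1) (- e1) b (1 - a - b) n2 n3 n1 n4.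
Proof.
case=> T g4 [h1 h2 h3] [h4 h5 h6] cov; split; first exact: tri_cycle.
- rewrite (_ : _ + _ = o + scz a e1 + scz b e2)//.
  by apply: vecz_eq => /=; ring.
- by rewrite !(dzD, dzN); split; lia.
- by rewrite !(dzD, dzN); split; lia.
move=> w; case: (cov (e1 + w)); rewrite !(dzD, dzN) => h.
- by apply: Or43; lia.
- by apply: Or41; lia.
- by apply: Or42; lia.
- by apply: Or44; lia.
Qed.

(** Only the fourth half-plane can cover [o + e1 + e2]. This point lies in the triangle formed by
    [o + e1], [o + e2] and the fourth point, where that half-plane contains nothing but the fourth
    point; so the two coincide. *)
Lemma tet_quad o e1 e2 a b n1 n2 n3 n4 : tet o e1 e2 a b n1 n2 n3 n4 ->
  1 <= a -> 1 <= b -> quad_outcome.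
Proof.
case=> [[D [g1 g2 g3] [s1 s2 s3] [s4 s5 s6]] g4 [h1 h2 h3] [h4 h5 h6] cov] a1 b1.
have n2e2 : dz n2 e2 < 0.
  rewrite ltNge; apply/negP => h.
  have : 0 <= (a - 1) * dz n2 e1 by rewrite mulr_ge0//; lia.
  have : 0 <= b * dz n2 e2 by rewrite mulr_ge0//; lia.
  lia.
have n3e1 : dz n3 e1 < 0.
  rewrite ltNge; apply/negP => h.
  have : 0 <= (b - 1) * dz n3 e2 by rewrite mulr_ge0//; lia.
  have : 0 <= a * dz n3 e1 by rewrite mulr_ge0//; lia.
  lia.
have [a1' b1'] : a = 1 /\ b = 1.
  case: (cov (e1 + e2)); rewrite dzD => h; [lia..|].
  set k := a * _ + b * _ in h h4 h5 h6.
  have E : (a + b - 1) * (dz n4 e1 + dz n4 e2 - k) =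
      (b - 1) * (dz n4 e1 - k) + (a - 1) * (dz n4 e2 - k) by rewrite /k; ring.
  have p0 : 0 <= (a + b - 1) * (dz n4 e1 + dz n4 e2 - k) by rewrite mulr_ge0//; lia.
  have p1 : (b - 1) * (dz n4 e1 - k) <= 0 by rewrite mulr_ge0_le0//; lia.
  have p2 : (a - 1) * (dz n4 e2 - k) <= 0 by rewrite mulr_ge0_le0//; lia.
  split.
    have /eqP : (a - 1) * (dz n4 e2 - k) = 0 by lia.
    by rewrite mulf_eq0 => /orP[/eqP|/eqP]; lia.
  have /eqP : (b - 1) * (dz n4 e1 - k) = 0 by lia.
  by rewrite mulf_eq0 => /orP[/eqP|/eqP]; lia.
subst a b; exists o, e1, e2, n1, n2, n4, n3; split => //.
- split => //; move: g4; rewrite (_ : _ + _ = o + e1 + e2)//.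
  by apply: vecz_eq => /=; ring.
- by split; lia.
- by split; lia.
Qed.

(** [a], [b] and [1 - a - b] are barycentric coordinates of the fourth point. If two were
    nonpositive, it would lie in the half-plane of the third of those corners; so two are at least
    1, and [tet_cycle] brings them to the front. *)
Lemma tet_outcome o e1 e2 a b n1 n2 n3 n4 :
  tet o e1 e2 a b n1 n2 n3 n4 -> quad_outcome.
Proof.
move=> T; have T2 := tet_cycle T; have T3 := tet_cycle T2.
have [[D _ [s1 s2 s3] [s4 s5 s6]] _ [h1 h2 h3] [h4 h5 h6] _] := T.
have [a0|a0] := leP a 0; have [b0|b0] := leP b 0.
- have : 0 <= a * dz n1 e1 by rewrite mulr_le0//; lia.
  have : 0 <= b * dz n1 e2 by rewrite mulr_le0//; lia.
  by lia.
- have [ab|ab] := leP (1 - a - b) 0.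
    have : 0 <= a * (dz n3 e1 - dz n3 e2) by rewrite mulr_le0//; lia.
    have : 0 <= (a + b - 1) * dz n3 e2 by rewrite mulr_ge0//; lia.
    by lia.
  by apply: (tet_quad T2); lia.
- have [ab|ab] := leP (1 - a - b) 0.
    have : 0 <= b * (dz n2 e2 - dz n2 e1) by rewrite mulr_le0//; lia.
    have : 0 <= (a + b - 1) * dz n2 e1 by rewrite mulr_ge0//; lia.
    by lia.
  by apply: (tet_quad T3); lia.
- by apply: (tet_quad T); lia.
Qed.

(** The covering makes [d] primitive, so Bezout completes it to a basis with some [e]. Testing the
    points k d + e and k d - e forces both normals to vanish on one [e + scz k0 d]: the boundaries
    are parallel. *)
Lemma split_outcome o d n1 n2 :
  Good n1 (dz n1 o) -> Good n2 (dz n2 (o + d)) -> dz n1 d < 0 -> 0 < dz n2 d ->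
  (forall w : vecz, 0 <= dz n1 w \/ dz n2 d <= dz n2 w) -> quad_outcome.
Proof.
move=> g1 g2 d1 d2 cov.
have [u [v]] := Bezoutz d.1 d.2; set g := gcdz _ _ => uv.
have [p pE] : exists p, d.1 = p * g by exists (d.1 %/ g)%Z; rewrite divzK// dvdz_gcdl.
have [q qE] : exists q, d.2 = q * g by exists (d.2 %/ g)%Z; rewrite divzK// dvdz_gcdr.
have g0 : 0 <= g by rewrite /g /gcdz.
have gE n : dz n d = g * dz n (p, q) by rewrite /dz pE qE /=; ring.
have g1' : g = 1.
  rewrite gE in d1; rewrite gE in d2.
  have gp : 0 < g.
    by rewrite lt_neqAle g0 andbT eq_sym; apply/eqP => g00; move: d1; rewrite g00 mul0r.
  have q2 : 0 < dz n2 (p, q) by rewrite -(pmulr_rgt0 _ gp).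
  have q1 : dz n1 (p, q) < 0 by rewrite -(pmulr_rlt0 _ gp).
  by case: (cov (p, q)); [lia|rewrite gE ger_pMl//; lia].
pose e : vecz := (- v, u).
have De : detz d e = 1 by rewrite /detz /= -g1' -uv; ring.
pose k0 := (dz n1 e %/ - dz n1 d)%Z.
have D0 : 0 < - dz n1 d by lia.
have k1 : k0 * - dz n1 d <= dz n1 e by apply: lez_floor; lia.
have k2 : dz n1 e < (k0 + 1) * - dz n1 d by exact: ltz_ceil.
have c1 k : k * - dz n1 d <= dz n1 e \/ 0 <= (k - 1) * dz n2 d + dz n2 e.
  by case: (cov (scz k d + e)); rewrite !dzD !dzZ; [left|right]; lia.
have c2 k : k * - dz n1 d <= - dz n1 e \/ 0 <= (k - 1) * dz n2 d - dz n2 e.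
  by case: (cov (scz k d - e)); rewrite !dzD !dzN !dzZ; [left|right]; lia.
have E1 : 0 <= k0 * dz n2 d + dz n2 e by case: (c1 (k0 + 1)); lia.
have E2 : dz n1 e = k0 * - dz n1 d by case: (c2 (- k0)); lia.
have E3 : k0 * dz n2 d + dz n2 e = 0 by case: (c2 (1 - k0)); lia.
have n1e : dz n1 (e + scz k0 d) = 0 by rewrite dzD dzZ; lia.
have n2e : dz n2 (e + scz k0 d) = 0 by rewrite dzD dzZ; lia.
exists o, d, (e + scz k0 d), n1, n2, n2, n1; split.
- by rewrite (_ : detz _ _ = detz d e); [rewrite De expr1n|rewrite /detz /=; ring].
- by split => //; rewrite dzD ?n1e ?n2e addr0.
- by split; lia.
- by rewrite n1e n2e.
Qed.

End outcome.

Section cover.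
Variable Good : vecz -> int -> Prop.
Hypothesis GoodW : forall n b b', Good n b -> b <= b' -> Good n b'.
Hypothesis Good0 : forall b, Good 0 b -> 0 < b.

Definition lattice_cover N (n : 'I_N -> vecz) (b : 'I_N -> int) :=
  (forall i, Good (n i) (b i)) /\ forall z, exists i, b i <= dz (n i) z.

Lemma cover_lonely N (n : 'I_N -> vecz) b :
  (forall N' (n' : 'I_N' -> vecz) b', lattice_cover n' b' -> (N <= N')%N) ->
  lattice_cover n b -> forall i, exists y, forall j, j != i -> dz (n j) y < b j.
Proof.
case: N n b => [n b _ _ [//]|N n b minN [G C] i].
apply: contrapT => /forallNP h.
suff : lattice_cover (n \o lift i) (b \o lift i) by move/minN; rewrite ltnn.
split=> [j|z]; first exact: G.
have /existsNP[j /not_implyP[ji /negP]] := h z; rewrite -leNgt => jz.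
by have [k jE|jE] := unliftP i j; [exists k; rewrite /= -jE|rewrite jE eqxx in ji].
Qed.

(** With [N] minimal, each half-plane has lattice points of its own, and its offset is raised to the
    least value attained on them. Doing this in turn keeps earlier tight points tight, since larger
    offsets only help strict inequalities. *)
Lemma tight_cover : (exists N (n : 'I_N -> vecz) b, lattice_cover n b) ->
  exists N (n : 'I_N -> vecz) b (y : 'I_N -> vecz), lattice_cover n b /\
    forall i j, if j == i then dz (n j) (y i) = b j else dz (n j) (y i) < b j.
Proof.
move=> [N0 [n0 [b0 c0]]].
have exN : exists N, `[< exists (n : 'I_N -> vecz) b, lattice_cover n b >].
  by exists N0; apply/asboolP; exists n0, b0.
have := ex_minnP exN; case=> N /asboolP[n [b c]] minN.
have {}minN N' (n' : 'I_N' -> vecz) b' : lattice_cover n' b' -> (N <= N')%N.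
  by move=> c'; apply: minN; apply/asboolP; exists n', b'.
suff step m : (m <= N)%N -> exists b, lattice_cover n b /\ forall i : 'I_N, (i < m)%N ->
    exists y, forall j, if j == i then dz (n j) y = b j else dz (n j) y < b j.
  have [b' [c' h]] := step N (leqnn N).
  have /choice[y hy] i : exists y, forall j, if j == i then dz (n j) y = b' j else dz (n j) y < b' j.
    exact: h.
  by exists N, n, b', y.
elim: m => [_|m IH mN]; first by exists b.
have [{}b [{}c h]] := IH (ltnW mN); pose i := Ordinal mN.
have [y0 y0P] := cover_lonely minN c i.
have lge y : (forall j, j != i -> dz (n j) y < b j) -> b i <= dz (n i) y.
  move=> yP; have [_ /(_ y)[j jy]] := c.
  by have [<-//|/yP] := eqVneq j i; rewrite ltNge jy.
pose P v := `[< exists y, (forall j, j != i -> dz (n j) y < b j) /\ dz (n i) y = b i + v%:Z >].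
have exP : exists v, P v.
  exists `|dz (n i) y0 - b i|%N; apply/asboolP; exists y0; split => //.
  by have := lge _ y0P; lia.
have := ex_minnP exP; case=> v /asboolP[y [yP yE]] minv.
pose b' j := if j == i then b i + v%:Z else b j.
have bb' j : b j <= b' j by rewrite /b'; case: eqP => [->|]; lia.
exists b'; split; [split|].
- by move=> j; have [G _] := c; exact: GoodW (G j) (bb' j).
- move=> z; have [zP|] := pselect (forall j, j != i -> dz (n j) z < b j).
    exists i; rewrite /b' eqxx.
    have zi := lge _ zP; have := minv `|dz (n i) z - b i|%N.
    have -> : P `|dz (n i) z - b i|%N by apply/asboolP; exists z; split => //; lia.
    by move=> /(_ isT); lia.
  move=> /existsNP[j /not_implyP[ji /negP]]; rewrite -leNgt => jz.
  by exists j; rewrite /b' (negbTE ji).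
move=> l; rewrite ltnS leq_eqVlt => /predU1P[lm|lm]; last have [w hw] := h _ lm.
- have -> : l = i by apply: val_inj.
  exists y => j; rewrite /b'; case: eqP => [->//|/eqP ji]; exact: yP.
- exists w => j; have := hw j; case: eqP => [->|jl] wj; last exact: lt_le_trans wj (bb' j).
  by rewrite wj /b'; case: eqP => // li; move: lm; rewrite li ltnn.
Qed.

(* Two tight points of the same parity would have a lattice midpoint, which no
   half-plane of the cover could contain. *)
Lemma tight_cover_le4 N (n : 'I_N -> vecz) (b : 'I_N -> int) (y : 'I_N -> vecz) :
  lattice_cover n b ->
  (forall i j, if j == i then dz (n j) (y i) = b j else dz (n j) (y i) < b j) ->
  (N <= 4)%N.
Proof.
move=> [_ C] T.
pose p i := ((y i).1 %% 2 == 0, (y i).2 %% 2 == 0)%Z.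
have : injective p.
  move=> i j [p1 p2]; apply/eqP; apply: contrapT => /negP ij.
  have [z [z1 z2]] : exists z : vecz,
      2 * z.1 = (y i).1 + (y j).1 /\ 2 * z.2 = (y i).2 + (y j).2.
    exists (((y i).1 + (y j).1) %/ 2, ((y i).2 + (y j).2) %/ 2)%Z.
    by move: p1 p2 => /=; split; lia.
  have [l] := C z; rewrite leNgt => /negP; apply.
  have E : 2 * dz (n l) z = dz (n l) (y i) + dz (n l) (y j).
    rewrite -dzD /dz /= -z1 -z2; ring.
  have := T i l; have := T j l; move: E.
  case: (eqVneq l i) => [->|li]; first by rewrite (negbTE ij); lia.
  by case: (l == j); lia.
by move=> /leq_card; rewrite card_ord card_prod card_bool.
Qed.

Lemma cover_outcome : (exists N (n : 'I_N -> vecz) b, lattice_cover n b) ->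
  quad_outcome Good \/ pinwheel_outcome Good.
Proof.
move=> /tight_cover[N [n [b [y [c T]]]]].
have := tight_cover_le4 c T; have [G C] := c.
have bE i : b i = dz (n i) (y i) by have := T i i; rewrite eqxx.
have lt i j : j != i -> dz (n j) (y i) < dz (n j) (y j).
  by move=> ji; have := T i j; rewrite (negbTE ji) bE.
have {}G i : Good (n i) (dz (n i) (y i)) by rewrite -bE.
have {}C z : exists i, dz (n i) (y i) <= dz (n i) z.
  by have [i] := C z; exists i; rewrite -bE.
move: n y G C lt {b c T bE}; case: N => [|[|[|[|[|//]]]]] n y G C lt _.
- by have [[]] := C 0.
- pose o := @Ordinal 1 0 isT.
  have {}C w : 0 <= dz (n o) w.
    by have [i] := C (y o + w); rewrite (_ : i = o) ?dzD; [lia|rewrite (ord1 i) [RHS]ord1].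
  have n0 : n o = 0.
    have := (C (1, 0), C (-1, 0), C (0, 1), C (0, -1)); rewrite /dz /= => -[[[? ?] ?] ?].
    by apply: vecz_eq => /=; lia.
  by have := G o; rewrite n0 => /Good0; rewrite /dz /=; lia.
- left; pose i0 := @Ordinal 2 0 isT; pose i1 := @Ordinal 2 1 isT.
  have := (G i0, G i1, lt i0 i1 isT, lt i1 i0 isT); set y0 := y i0; set y1 := y i1.
  move=> [[[G0 G1] l01] l10].
  have yE : y1 = y0 + (y1 - y0) by rewrite addrC subrK.
  apply: (@split_outcome _ y0 (y1 - y0) (n i0) (n i1)) => //.
  + by rewrite -yE.
  + by rewrite dzD dzN; lia.
  + by rewrite dzD dzN; lia.
  move=> w; have [[[|[|//]] h]] := C (y0 + w); rewrite (bool_irrelevance h isT) -/i0 -/i1.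
  + by rewrite dzD -/y0; left; lia.
  + by rewrite !(dzD, dzN) -/y1; right; lia.
- pose i0 := @Ordinal 3 0 isT; pose i1 := @Ordinal 3 1 isT; pose i2 := @Ordinal 3 2 isT.
  have := (lt i0 i1 isT, lt i1 i0 isT, lt i0 i2 isT, lt i2 i0 isT, lt i1 i2 isT, lt i2 i1 isT).
  have := (G i0, G i1, G i2).
  have {}C z : [\/ dz (n i0) (y i0) <= dz (n i0) z, dz (n i1) (y i1) <= dz (n i1) z |
                   dz (n i2) (y i2) <= dz (n i2) z].
    by have [[[|[|[|//]]] h]] := C z; rewrite (bool_irrelevance h isT);
      [apply: Or31|apply: Or32|apply: Or33].
  move: C; set y0 := y i0; set y1 := y i1; set y2 := y i2.
  move=> C [[G0 G1] G2] [[[[[l1 l2] l3] l4] l5] l6].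
  have y1E : y0 + (y1 - y0) = y1 by rewrite addrC subrK.
  have y2E : y0 + (y2 - y0) = y2 by rewrite addrC subrK.
  apply: (@tri_outcome _ y0 (y1 - y0) (y2 - y0) (n i0) (n i1) (n i2)); last first.
    by move=> z; rewrite y1E y2E.
  have S1 : [/\ dz (n i0) (y1 - y0) < 0, 0 < dz (n i1) (y1 - y0)
     & dz (n i2) (y1 - y0) < dz (n i2) (y2 - y0)].
    by rewrite !(dzD, dzN); split; lia.
  have S2 : [/\ dz (n i0) (y2 - y0) < 0, dz (n i1) (y2 - y0) < dz (n i1) (y1 - y0)
     & 0 < dz (n i2) (y2 - y0)].
    by rewrite !(dzD, dzN); split; lia.
  split; rewrite ?y1E ?y2E //.
  apply: (det_triangle (P := fun=> False) S1 S2) => [w|? ? ? ? ? ? ? ? ? []].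
  by case: (C (y0 + w)); rewrite !(dzD, dzN) => h;
    [apply: Or41|apply: Or42|apply: Or43]; lia.
- left; pose i0 := @Ordinal 4 0 isT; pose i1 := @Ordinal 4 1 isT.
  pose i2 := @Ordinal 4 2 isT; pose i3 := @Ordinal 4 3 isT.
  have := (lt i0 i1 isT, lt i1 i0 isT, lt i0 i2 isT, lt i2 i0 isT, lt i1 i2 isT, lt i2 i1 isT).
  have := (lt i0 i3 isT, lt i1 i3 isT, lt i2 i3 isT, lt i3 i0 isT, lt i3 i1 isT, lt i3 i2 isT).
  have := (G i0, G i1, G i2, G i3).
  have {}C z : [\/ dz (n i0) (y i0) <= dz (n i0) z, dz (n i1) (y i1) <= dz (n i1) z,
                   dz (n i2) (y i2) <= dz (n i2) z | dz (n i3) (y i3) <= dz (n i3) z].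
    by have [[[|[|[|[|//]]]] h]] := C z; rewrite (bool_irrelevance h isT);
      [apply: Or41|apply: Or42|apply: Or43|apply: Or44].
  move: C; set y0 := y i0; set y1 := y i1; set y2 := y i2; set y3 := y i3.
  move=> C [[[G0 G1] G2] G3] [[[[[k1 k2] k3] k4] k5] k6] [[[[[l1 l2] l3] l4] l5] l6].
  have y1E : y0 + (y1 - y0) = y1 by rewrite addrC subrK.
  have y2E : y0 + (y2 - y0) = y2 by rewrite addrC subrK.
  set e1 := y1 - y0 in y1E *; set e2 := y2 - y0 in y2E *.
  have S1 : [/\ dz (n i0) e1 < 0, 0 < dz (n i1) e1 & dz (n i2) e1 < dz (n i2) e2].
    by rewrite !(dzD, dzN); split; lia.
  have S2 : [/\ dz (n i0) e2 < 0, dz (n i1) e2 < dz (n i1) e1 & 0 < dz (n i2) e2].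
    by rewrite !(dzD, dzN); split; lia.
  have {}C w : [\/ 0 <= dz (n i0) w, dz (n i1) e1 <= dz (n i1) w,
                   dz (n i2) e2 <= dz (n i2) w | dz (n i3) (y3 - y0) <= dz (n i3) w].
    by case: (C (y0 + w)); rewrite !(dzD, dzN) => h;
      [apply: Or41|apply: Or42|apply: Or43|apply: Or44]; lia.
  (* The fourth half-plane contains no corner of the triangle, hence no point of it. *)
  have D : detz e1 e2 ^+ 2 = 1.
    apply: (det_triangle S1 S2 C) => w a' b' d d0 wE a0 b0 ab h.
    have := congr1 (dz (n i3)) wE; rewrite dzD !dzZ => E.
    have p1 : a' * (dz (n i3) e1 - dz (n i3) (y3 - y0)) <= 0.
      by rewrite mulr_ge0_le0// /e1 !(dzD, dzN); lia.
    have p2 : b' * (dz (n i3) e2 - dz (n i3) (y3 - y0)) <= 0.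
      by rewrite mulr_ge0_le0// /e2 !(dzD, dzN); lia.
    have y3p : 0 < dz (n i3) (y3 - y0) by rewrite !(dzD, dzN); lia.
    have p3 : d * dz (n i3) (y3 - y0) <= d * dz (n i3) w by rewrite ler_pM2l.
    have p4 : 0 <= (d - a' - b') * dz (n i3) (y3 - y0) by rewrite mulr_ge0//; lia.
    have [z1|z1] := eqVneq a' 0; last first.
      have : 0 < a' * (dz (n i3) (y3 - y0) - dz (n i3) e1).
        by rewrite mulr_gt0//; [lia|rewrite /e1 !(dzD, dzN); lia].
      by lia.
    have [z2|z2] := eqVneq b' 0; last first.
      have : 0 < b' * (dz (n i3) (y3 - y0) - dz (n i3) e2).
        by rewrite mulr_gt0//; [lia|rewrite /e2 !(dzD, dzN); lia].
      by lia.
    have : 0 < d * dz (n i3) (y3 - y0) by exact: mulr_gt0.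
    by move: p3 E; rewrite z1 z2; lia.
  pose a := detz e1 e2 * detz (y3 - y0) e2; pose b := detz e1 e2 * detz e1 (y3 - y0).
  have y3E : y3 - y0 = scz a e1 + scz b e2.
    apply: vecz_eq; rewrite -[LHS]mul1r -D /a /b /detz /=; ring.
  have Y3 : y0 + scz a e1 + scz b e2 = y3 by rewrite -addrA -y3E addrC subrK.
  apply: (@tet_outcome _ y0 e1 e2 a b (n i0) (n i1) (n i2) (n i3)).
  have nE m : a * dz m e1 + b * dz m e2 = dz m (y3 - y0) by rewrite y3E dzD !dzZ.
  split; rewrite ?nE ?Y3 //.
  + by split => //; rewrite ?y1E ?y2E.
  + by rewrite !(dzD, dzN); split; lia.
  + by rewrite !(dzD, dzN); split; lia.
Qed.

End cover.

(** * From integral half-planes back to cuts *)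

Definition vecR (R : realType) (y : vecz) : 'rV[R]_2 := vec2 y.1%:~R y.2%:~R.
Arguments vecR {R}.

Section outcome_cut.
Context {R : realType}.

Lemma Z2_vecR y : Z2 (vecR y : 'rV[R]_2).
Proof. by apply: ord2P; rewrite ?(vec2_0, vec2_1) intr_int. Qed.

Lemma dot_vecR n y : dot (vecR n : 'rV[R]_2) (vecR y) = (dz n y)%:~R.
Proof. by rewrite dot2E !vec2_0 !vec2_1 /dz rmorphD !rmorphM. Qed.

Lemma frame_of_basis (o e1 e2 : vecz) : detz e1 e2 ^+ 2 = 1 ->
  exists F : frame R, forall n,
    (forall p, dot (vecR n) p =
       (dz n o)%:~R + (dz n e1)%:~R * cX F p + (dz n e2)%:~R * cY F p) /\
    (forall d, dot (vecR n) d =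
       (dz n e1)%:~R * dot (fu F) d + (dz n e2)%:~R * dot (fv F) d).
Proof.
move=> D; set t := detz e1 e2 in D.
pose u := scz t (e2.2, - e2.1); pose v := scz t (- e1.2, e1.1).
have DR : (t%:~R : R) ^+ 2 = 1 by rewrite -rmorphXn D.
have tE : (t%:~R : R) = e1.1%:~R * e2.2%:~R - e1.2%:~R * e2.1%:~R.
  by rewrite /t /detz rmorphB !rmorphM.
have uE : (vecR u : 'rV[R]_2) = t%:~R *: vec2 e2.2%:~R (- e2.1%:~R).
  by apply/rowP; apply: ord2P; rewrite [RHS]mxE !(vec2_0, vec2_1) /u rmorphM ?rmorphN.
have vE : (vecR v : 'rV[R]_2) = t%:~R *: vec2 (- e1.2%:~R) e1.1%:~R.
  by apply/rowP; apply: ord2P; rewrite [RHS]mxE !(vec2_0, vec2_1) /v rmorphM ?rmorphN.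
have det1 : ((vecR u : 'rV[R]_2) 0 0 * (vecR v : 'rV[R]_2) 0 1
   - (vecR u : 'rV[R]_2) 0 1 * (vecR v : 'rV[R]_2) 0 0) ^+ 2 = 1.
  rewrite uE vE !(mxE _ _ _ 0) ?mxE /=.
  transitivity ((t%:~R : R) ^+ 2 * (t%:~R : R) ^+ 2 * (t%:~R : R) ^+ 2).
    by rewrite tE; ring.
  by rewrite DR !mulr1.
exists (@Frame R (vecR u) (- (dz u o)%:~R) (vecR v) (- (dz v o)%:~R)
  (Z2_vecR u) (ltac:(by rewrite rpredN intr_int)) (Z2_vecR v)
  (ltac:(by rewrite rpredN intr_int)) det1) => n.
have lin (d : 'rV[R]_2) : dot (vecR n) d = (dz n e1)%:~R * dot (vecR u) d + (dz n e2)%:~R * dot (vecR v) d.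
  rewrite uE vE !dotZl !dot2E !(vec2_0, vec2_1) /dz !rmorphD !rmorphM /=.
  transitivity ((t%:~R : R) ^+ 2 * (n.1%:~R * d 0 0 + n.2%:~R * d 0 1)).
    by rewrite DR mul1r.
  by rewrite tE; ring.
split=> [p|d]; last exact: lin.
rewrite /cX /cY /= lin.
have := lin (vecR o); rewrite !dot_vecR => ->; ring.
Qed.

Lemma dzDR n y z : (dz n (y + z))%:~R = (dz n y)%:~R + (dz n z)%:~R :> R.
Proof. by rewrite dzD intrD. Qed.

Variables (k : nat) (f : 'rV[R]_2) (r : 'I_k -> 'rV[R]_2).
Hypothesis r0 : forall j, r j <> 0.
Variable s : 'rV[R]_k.
Hypothesis sQ : quadrilateral_closure f r s.
Variable gam : 'I_k -> R.
Hypothesis gam0 : forall j, 0 < s 0 j -> 0 < gam j.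

Definition separates (n : vecz) (b : int) :=
  dot (vecR n) f < b%:~R /\
  forall j, 0 < s 0 j -> dot (vecR n) (f + (gam j)^-1 *: r j) < b%:~R.

Lemma separates_slack n b : separates n b ->
  0 < b%:~R - dot (vecR n) f /\
  forall j, 0 < s 0 j ->
    0 <= gam j * (b%:~R - dot (vecR n) f) - dot (vecR n) (r j).
Proof.
move=> [h1 h2]; split=> [|j sj]; first by rewrite subr_gt0.
have g0 := gam0 sj; have := h2 j sj; rewrite dotDr dotZr => h.
have : gam j * (dot (vecR n) f + (gam j)^-1 * dot (vecR n) (r j)) <= gam j * b%:~R.
  by rewrite ler_pM2l// ltW.
by rewrite mulrDr mulrA divff ?gt_eqF// mul1r mulrBr; lra.
Qed.

Lemma quad_outcome_cut : quad_outcome separates -> 1 <= \sum_j gam j * s 0 j.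
Proof.
move=> [y [e1 [e2 [n0 [n1 [n2 [n3 [D [g0 g1 g2 g3] X Y]]]]]]]].
have [F hF] := frame_of_basis y D.
have {g0}[f0 s0] := separates_slack g0; have {g1}[f1 s1] := separates_slack g1.
have {g2}[f2 s2] := separates_slack g2; have {g3}[f3 s3] := separates_slack g3.
move: f0 s0 f1 s1 f2 s2 f3 s3; rewrite !dzDR !(proj1 (hF _)).
move: X Y => [X0 X1 X2 X3] [Y0 Y1 Y2 Y3] f0 s0 f1 s1 f2 s2 f3 s3.
have cast (x : int) : 0 <= x -> 0 <= (x%:~R : R) by rewrite ler0z.
have castN (x : int) : x <= 0 -> 0 <= - (x%:~R : R) by rewrite oppr_ge0 lerz0.
apply: (quad_cut r0 sQ (F := F)
  (p0 := - (dz n0 e1)%:~R) (q0 := - (dz n0 e2)%:~R)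
  (p1 := (dz n1 e1)%:~R) (q1 := - (dz n1 e2)%:~R)
  (p2 := (dz n2 e1)%:~R) (q2 := (dz n2 e2)%:~R)
  (p3 := - (dz n3 e1)%:~R) (q3 := (dz n3 e2)%:~R)).
- by split; [exact: castN|exact: cast|exact: cast|exact: castN].
- by split; [exact: castN|exact: castN|exact: cast|exact: cast].
- lra.
- lra.
- lra.
- lra.
move=> j sj; split; first exact: ltW (gam0 sj).
move: (s0 j sj) (s1 j sj) (s2 j sj) (s3 j sj); rewrite !(proj2 (hF _)).
by split; lra.
Qed.

Lemma pinwheel_outcome_cut :
  pinwheel_outcome separates -> 2 / 3 <= \sum_j gam j * s 0 j.
Proof.
move=> [y [e1 [e2 [n1 [n2 [n3 [D [g1 g2 g3] [X1 X2 X3] [Y1 Y2 Y3]]]]]]]].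
have [F hF] := frame_of_basis y D.
have {g1}[f1 s1] := separates_slack g1.
have {g2}[f2 s2] := separates_slack g2; have {g3}[f3 s3] := separates_slack g3.
move: f1 s1 f2 s2 f3 s3; rewrite !dzDR !(proj1 (hF _)).
move=> f1 s1 f2 s2 f3 s3.
apply: (pinwheel_cut r0 sQ (F := F) (A := - (dz n1 e1)%:~R) (B := - (dz n1 e2)%:~R)
  (P := (dz n2 e1)%:~R) (Q := (dz n2 e2)%:~R)
  (C := - (dz n3 e1)%:~R) (E := (dz n3 e2)%:~R)).
- by rewrite lerN2 ler_int Y1 oppr_gt0 ltrz0 X1.
- by rewrite ler0z ltr_int.
- by rewrite oppr_ge0 lerz0.
- by rewrite ltr0z.
- lra.
- lra.
- lra.
move=> j sj; split; first exact: ltW (gam0 sj).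
move: (s1 j sj) (s2 j sj) (s3 j sj); rewrite !(proj2 (hF _)).
by split; lra.
Qed.

End outcome_cut.

(** For a large [N], rounding [N] times [a] down to integers costs less than the bound [c i], which
    does not depend on [N]. *)
Lemma integral_direction (R : realType) m (w : 'I_m -> 'rV[R]_2) (a : 'rV[R]_2) :
  (forall i, dot a (w i) < 0) -> exists n, forall i, dot (vecR n) (w i) < 0.
Proof.
move=> aw.
pose c i := 1 + `|w i 0 0| + `|w i 0 1|.
have [e e0 eP] : exists2 e, 0 < e &
    forall i x, 0 < x <= e -> dot a (w i) + x * c i < 0.
  apply: uniform_small => i.
  have c0 : 0 < c i by rewrite /c -addrA ltr_pwDl ?addr_ge0.
  exists (- dot a (w i) / (2 * c i)) => [|x /andP[x0]].
    by rewrite divr_gt0 ?mulr_gt0// oppr_gt0.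
  rewrite ler_pdivlMr ?mulr_gt0// => h; have := aw i.
  by have := mulr_gt0 x0 c0; lra.
pose N : R := (Num.bound e^-1)%:R.
have N0 : 0 < N.
  have /archi_boundP : 0 <= e^-1 by rewrite invr_ge0 ltW.
  by apply: le_lt_trans; rewrite invr_ge0 ltW.
have Ne : 0 < N^-1 <= e.
  rewrite invr_gt0 N0 -[e in _ <= e]invrK lef_pV2 ?posrE ?invr_gt0//.
  by apply/ltW/archi_boundP; rewrite invr_ge0 ltW.
exists (Num.floor (N * a 0 0), Num.floor (N * a 0 1)) => i.
rewrite dot2E !(vec2_0, vec2_1).
have fl (x : R) : 0 <= x - (Num.floor x)%:~R <= 1.
  by rewrite subr_ge0 floor_le/= lerBlDl ltW// -intrD1 floorD1_gt.
have := fl (N * a 0 0); have := fl (N * a 0 1).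
set d1 := _ - _ => /andP[d10 d11]; set d0 := N * a 0 0 - _ => /andP[d00 d01].
have -> : (Num.floor (N * a 0 0))%:~R = N * a 0 0 - d0 by rewrite /d0; lra.
have -> : (Num.floor (N * a 0 1))%:~R = N * a 0 1 - d1 by rewrite /d1; lra.
have := eP i _ Ne; rewrite dot2E => h.
have {}h : N * (a 0 0 * w i 0 0 + a 0 1 * w i 0 1) + c i < 0.
  have := h; rewrite -(pmulr_rlt0 _ N0) mulrDr mulrA divff ?gt_eqF//.
  by rewrite mul1r.
have b (d y : R) : 0 <= d -> d <= 1 -> - (d * y) <= `|y|.
  move=> d_0 d_1; rewrite (le_trans (ler_norm _))// normrN normrM.
  by rewrite ger0_norm// ler_piMl.
have := b _ (w i 0 0) d00 d01; have := b _ (w i 0 1) d10 d11.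
by move: h; rewrite /c; lra.
Qed.

Lemma cover_fin (Good : vecz -> int -> Prop) (T : finType) (n : T -> vecz) (b : T -> int) :
  (forall t, Good (n t) (b t)) -> (forall z, exists t, b t <= dz (n t) z) ->
  exists N (n' : 'I_N -> vecz) b', lattice_cover Good n' b'.
Proof.
move=> G C; exists #|T|, (n \o enum_val), (b \o enum_val); split=> [i|z]; first exact: G.
by have [t tz] := C z; exists (enum_rank t); rewrite /= enum_rankK.
Qed.

Section covering.
Context {R : realType} (k : nat) (f : 'rV[R]_2) (r : 'I_k -> 'rV[R]_2).
Variables (s : 'rV[R]_k) (gam : 'I_k -> R).
Hypothesis gam0 : forall j, 0 < s 0 j -> 0 < gam j.
Hypothesis gamZ : forall t : 'rV[R]_k, (forall j, 0 <= t 0 j) ->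
  (forall j, t 0 j != 0 -> 0 < s 0 j) ->
  Z2 (f + \sum_j t 0 j *: r j) -> 1 < \sum_j gam j * t 0 j.

Let pts (i : 'I_k.+1) := if unlift ord0 i is Some j then
  (if 0 < s 0 j then f + (gam j)^-1 *: r j else f) else f.

Let separatesP n b : (forall i, dot (vecR n) (pts i) < b%:~R) -> separates f r s gam n b.
Proof.
move=> h; split; first by have := h ord0; rewrite /pts unlift_none.
by move=> j sj; have := h (lift ord0 j); rewrite /pts liftK sj.
Qed.

(** Otherwise Gordan's alternative makes [y] a convex combination of the generators [pts] of K, and
    its coefficients divided by [gam j] form a feasible t of weight at most 1. *)
Let separate_point y : exists n, separates f r s gam n (dz n y).
Proof.
have [[a /integral_direction[n nP]]|[l [l0 [i0 li0] lE]]] := gordan (fun i => pts i - vecR y).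
  exists n; apply: separatesP => i.
  by have := nP i; rewrite dotDr dotNr subr_lt0 dot_vecR.
exfalso; pose L := \sum_i l i.
have L0 : 0 < L.
  by rewrite /L (bigD1 i0)//= ltr_pwDl// sumr_ge0.
have Ln : L != 0 by rewrite gt_eqF.
pose t : 'rV[R]_k := \row_j (if 0 < s 0 j then l (lift ord0 j) / (L * gam j) else 0).
have yE : f + \sum_j t 0 j *: r j = vecR y.
  apply: (scalerI Ln); rewrite scalerDr.
  have : \sum_i l i *: pts i = L *: vecR y.
    transitivity (\sum_i (l i *: (pts i - vecR y) + l i *: vecR y)).
      by apply: eq_bigr => i _; rewrite -scalerDr subrK.
    by rewrite big_split /= lE add0r -scaler_suml.
  move=> <-; have -> : L *: f = \sum_i l i *: f by rewrite scaler_suml.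
  rewrite scaler_sumr !big_ord_recl -addrA; congr (_ + _).
    by rewrite /pts unlift_none.
  rewrite -big_split /=; apply: eq_bigr => j _; rewrite /pts liftK /t mxE scalerA.
  case: ifP => sj; last by rewrite mulr0 scale0r addr0.
  have gn : gam j != 0 by rewrite gt_eqF// gam0.
  rewrite scalerDr scalerA; congr (_ + _ *: _).
  by field; rewrite Ln gn.
have := gamZ (t := t); rewrite yE => /(_ _ _ (Z2_vecR y)) h.
have : 1 < \sum_j gam j * t 0 j.
  apply: h => j; rewrite mxE; case: ifP => // sj; last by rewrite eqxx.
  by rewrite divr_ge0// mulr_ge0 ?(ltW L0)// ltW// gam0.
apply/negP; rewrite -leNgt.
have -> : \sum_j gam j * t 0 j = (\sum_j (if 0 < s 0 j then l (lift ord0 j) else 0)) / L.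
  rewrite mulr_suml; apply: eq_bigr => j _; rewrite mxE.
  case: ifP => sj; last by rewrite mulr0 mul0r.
  have gn : gam j != 0 by rewrite gt_eqF// gam0.
  by field; rewrite Ln gn.
rewrite ler_pdivrMr// mul1r /L [leRHS]big_ord_recl.
rewrite ler_wpDl// ler_sum// => j _; case: ifP => //.
Qed.

(** K is bounded: four axis-parallel half-planes cover the lattice outside a box, and each of the
    finitely many points inside gets its own half-plane. *)
Lemma separates_cover : exists N (n : 'I_N -> vecz) b, lattice_cover (separates f r s gam) n b.
Proof.
have [nf nfP] := choice separate_point.
pose S := \sum_i (`|pts i 0 0| + `|pts i 0 1|).
pose M := Num.bound S.
have S0 : 0 <= S by apply: sumr_ge0 => i _; rewrite addr_ge0.
have SM : S < M%:R by exact: archi_boundP.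
have bd i : `|pts i 0 0| < M%:R /\ `|pts i 0 1| < M%:R.
  have : `|pts i 0 0| + `|pts i 0 1| <= S.
    by rewrite /S (bigD1 i)//= lerDl sumr_ge0// => j _; rewrite addr_ge0.
  by have := normr_ge0 (pts i 0 0); have := normr_ge0 (pts i 0 1); lra.
pose T : finType := ('I_(M + M) * 'I_(M + M) + bool * bool)%type.
pose q (t : 'I_(M + M) * 'I_(M + M)) : vecz := (t.1%:Z - M%:Z, t.2%:Z - M%:Z).
pose dir (c : bool * bool) : vecz :=
  if c.1 then (if c.2 then (1, 0) else (-1, 0)) else (if c.2 then (0, 1) else (0, -1)).
apply: (@cover_fin _ T (fun t => match t with inl t => nf (q t) | inr c => dir c end)
  (fun t => match t with inl t => dz (nf (q t)) (q t) | inr c => M%:Z end)).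
- case=> [t|c]; first exact: nfP.
  apply: separatesP => i; rewrite dot2E !(vec2_0, vec2_1).
  have [] := bd i; rewrite !ltr_norml => /andP[h1 h2] /andP[h3 h4].
  have -> : (M%:Z%:~R : R) = M%:R by [].
  case: c => [[] []]; rewrite /dir /= ?rmorphN1 ?rmorph1 ?rmorph0; lra.
move=> z; have [h1|h1] := leP M%:Z z.1.
  by exists (inr (true, true)); rewrite /dz /=; lia.
have [h2|h2] := leP z.1 (- M%:Z).
  by exists (inr (true, false)); rewrite /dz /=; lia.
have [h3|h3] := leP M%:Z z.2.
  by exists (inr (false, true)); rewrite /dz /=; lia.
have [h4|h4] := leP z.2 (- M%:Z).
  by exists (inr (false, false)); rewrite /dz /=; lia.
have i1 : (absz (z.1 + M%:Z)%R < M + M)%N by lia.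
have i2 : (absz (z.2 + M%:Z)%R < M + M)%N by lia.
exists (inl (Ordinal i1, Ordinal i2)).
by rewrite (_ : q _ = z)//; apply: vecz_eq; rewrite /q /=; lia.
Qed.

End covering.

(** * Separation from the corner polyhedron *)

Lemma convex_sum (R : realType) (E : lmodType R) (A : set E) m (t : 'I_m -> E)
    (l : 'I_m -> R) : convex_set A -> (forall i, A (t i)) ->
  (forall i, 0 <= l i) -> 0 < \sum_i l i ->
  A ((\sum_i l i)^-1 *: \sum_i l i *: t i).
Proof.
move=> /convex_setP cA; elim: m t l => [|m IH] t l At l0; first by rewrite big_ord0 ltxx.
rewrite !big_ord_recl; set L' := \sum_(i < m) _; set v := \sum_(i < m) _ => L0.
have Ln : l ord0 + L' != 0 by rewrite gt_eqF.
have L'0 : 0 <= L' by apply: sumr_ge0.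
have [L'e|L'n] := eqVneq L' 0.
  have v0 : v = 0.
    rewrite /v big1// => i _; have /eqP := L'e; rewrite psumr_eq0// => /allP/(_ i).
    by rewrite mem_index_enum => /(_ isT)/= /eqP ->; rewrite scale0r.
  by rewrite L'e addr0 in Ln *; rewrite v0 addr0 scalerA mulVf// scale1r.
have L'p : 0 < L' by rewrite lt_neqAle eq_sym L'n.
have := cA (t ord0) (L'^-1 *: v) (l ord0 / (l ord0 + L')).
rewrite (_ : _ *: t ord0 + _ = (l ord0 + L')^-1 *: (l ord0 *: t ord0 + v)).
  apply; rewrite ?At//.
    by rewrite divr_ge0 ?(ltW L0)//= ler_pdivrMr// mul1r lerDl.
  by apply: IH.
rewrite scalerDr !scalerA mulrC; congr (_ + _ *: _).
by field; rewrite Ln L'n.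
Qed.

Lemma rational_multiple (R : realType) (x : R) : rational x ->
  exists2 N : nat, (0 < N)%N & N%:R * x \is a Num.int.
Proof.
move=> [q _ <-]; exists (absz (denq q)); first by rewrite absz_gt0 denq_neq0.
rewrite (_ : _ * _ = (numq q)%:~R) ?intr_int//.
rewrite /ratr mulrC -[X in _ * X](_ : (denq q)%:~R = _); last first.
  by rewrite -[in LHS](gez0_abs (ltW (denq_gt0 q))).
by rewrite divfK// intr_eq0 denq_neq0.
Qed.

Lemma Q2_multiple (R : realType) (d : 'rV[R]_2) : Q2 d ->
  exists2 N : nat, (0 < N)%N & Z2 (N%:R *: d).
Proof.
move=> dQ; have [a a0 aZ] := rational_multiple (dQ 0).
have [b b0 bZ] := rational_multiple (dQ 1).
exists (a * b)%N; first by rewrite muln_gt0 a0.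
apply: ord2P; rewrite mxE natrM.
  by rewrite mulrAC rpredM// natr_int.
by rewrite -mulrA rpredM// natr_int.
Qed.

Section weights.
Context {R : realType} (k : nat) (f : 'rV[R]_2) (r : 'I_k -> 'rV[R]_2).
Hypothesis rQ : forall j, Q2 (r j).

(** Rationality enters here: a multiple of [r j] is integral, so feasible points can be moved
    arbitrarily far along the j-th axis, and convexity fills the gaps. *)
Lemma relaxed_corner_ray c j a : relaxed_corner f r c -> 0 <= a ->
  relaxed_corner f r (c + a *: delta_mx 0 j).
Proof.
move=> Cc a0; set C := relaxed_corner f r.
have /convex_setP cC : convex_set C by exact: conv_hull_convex.
suff : relaxed_corner f r `<=` [set x | C (x + a *: delta_mx 0 j)] by exact.
apply: conv_hull_min => [|t [t0 tZ]].
  apply/convex_setP => x y l l01 /= hx hy.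
  have := cC _ _ _ l01 hx hy; congr C.
  by rewrite !scalerDr addrACA -scalerDl (addrC l) subrK scale1r.
have [N N0 NZ] := Q2_multiple (rQ j).
pose M := (Num.bound a * N)%N.
have NR : 0 < (N%:R : R) by rewrite ltr0n.
have aM : a < M%:R.
  rewrite /M natrM (lt_le_trans (archi_boundP a0))// ler_peMr// ler1n.
  exact: N0.
have Mp : 0 < (M%:R : R) by exact: le_lt_trans a0 aM.
have Ct : C t by apply: sub_conv_hull.
have CM : C (t + M%:R *: delta_mx 0 j).
  apply: sub_conv_hull; split=> [i|/=].
    by rewrite !mxE addr_ge0 ?t0// mulr_ge0// ler0n.
  have -> : f + \sum_(i < k) (t + M%:R *: delta_mx 0 j) 0 i *: r i =
      (f + \sum_(i < k) t 0 i *: r i) + (Num.bound a)%:R *: (N%:R *: r j).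
    rewrite -addrA; congr +%R; rewrite scalerA -natrM -/M.
    rewrite (bigD1 j)//= [in RHS](bigD1 j)//= !mxE !eqxx mulr1 scalerDl -!addrA.
    congr +%R; rewrite addrC; congr +%R; apply: eq_bigr => i ij.
    by rewrite !mxE eqxx (negbTE ij) mulr0 addr0.
  move=> i; rewrite mxE rpredD ?tZ// mxE rpredM ?natr_int//; exact: NZ.
have aM01 : 0 <= a / M%:R <= 1.
  by rewrite divr_ge0 ?(ltW Mp)//= ler_pdivrMr// mul1r ltW.
have := cC _ _ _ aM01 CM Ct; congr C.
rewrite scalerDr scalerA divfK ?gt_eqF// addrAC -scalerDl addrC [in X in _ + X]addrC.
by rewrite subrK scale1r addrC.
Qed.

Lemma relaxed_corner_up c (mu : 'rV[R]_k) : relaxed_corner f r c ->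
  (forall j, 0 <= mu 0 j) -> relaxed_corner f r (c + mu).
Proof.
move=> Cc mu0; rewrite (row_sum_delta mu).
elim: (index_enum _) => [|j l IH]; first by rewrite big_nil addr0.
by rewrite big_cons addrCA addrC; apply: relaxed_corner_ray.
Qed.

(** Including the vectors [- delta_mx 0 j] in Gordan's alternative makes the weights positive; in
    the other case [x] dominates a convex combination of the [t i], and R_f is closed upwards. *)
Lemma finite_separation m (t : 'I_m -> 'rV[R]_k) x :
  (forall i, relaxed_corner f r (t i)) -> ~ relaxed_corner f r x ->
  exists g : 'rV[R]_k, (forall j, 0 < g 0 j) /\ forall i, dot g x < dot g (t i).
Proof.
move=> Ct Cx.
pose w (i : 'I_(m + k)) : 'rV[R]_k :=
  match fintype.split i with inl i => x - t i | inr j => - delta_mx 0 j end.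
have wl i : w (lshift k i) = x - t i by rewrite /w (unsplitK (inl i)).
have wr j : w (rshift m j) = - delta_mx 0 j by rewrite /w (unsplitK (inr j)).
have [[g gP]|[l [l0 [i0 li0] lE]]] := gordan w.
  exists g; split=> [j|i].
    by have := gP (rshift m j); rewrite wr dotNr dot_delta oppr_lt0.
  by have := gP (lshift k i); rewrite wl dotDr dotNr subr_lt0.
exfalso; apply: Cx.
pose L := \sum_i l (lshift k i).
have L0 : 0 <= L by apply: sumr_ge0.
pose mu : 'rV[R]_k := \row_j l (rshift m j).
have E : L *: x = \sum_i l (lshift k i) *: t i + mu.
  apply/eqP; rewrite -subr_eq0; apply/eqP; rewrite -[RHS]lE big_split_ord /=.
  rewrite opprD addrA /L scaler_suml.
  have -> : \sum_(i < m) l (lshift k i) *: w (lshift k i) =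
      \sum_i l (lshift k i) *: x - \sum_i l (lshift k i) *: t i.
    rewrite -sumrN -big_split /=; apply: eq_bigr => i _.
    by rewrite wl scalerBr.
  congr +%R; rewrite (row_sum_delta mu) -sumrN; apply: eq_bigr => j _.
  by rewrite wr scalerN mxE.
have [Le|Ln] := eqVneq L 0.
  have ll i : l (lshift k i) = 0.
    have /eqP := Le; rewrite psumr_eq0// => /allP/(_ i).
    by rewrite mem_index_enum => /(_ isT)/= /eqP.
  have mu0 : mu = 0.
    move: E; rewrite Le scale0r big1 ?add0r// => i _.
    by rewrite ll scale0r.
  move: li0; rewrite -(splitK i0); case: (fintype.split i0) => [i|j] /=.
    by rewrite ll ltxx.
  by have := congr1 (fun v : 'rV_k => v 0 j) mu0; rewrite !mxE => ->; rewrite ltxx.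
have Lp : 0 < L by rewrite lt_neqAle eq_sym Ln.
rewrite (_ : x = L^-1 *: (\sum_i l (lshift k i) *: t i) + L^-1 *: mu); last first.
  by rewrite -scalerDr -E scalerA mulVf// scale1r.
apply: relaxed_corner_up => [|j].
  by apply: convex_sum => //; exact: conv_hull_convex.
by rewrite !mxE mulr_ge0// invr_ge0.
Qed.

End weights.

Section separation.
Context {R : realType} (k : nat) (f : 'rV[R]_2) (r : 'I_k -> 'rV[R]_2).
Hypothesis rQ : forall j, Q2 (r j).
Hypothesis fZ : ~ Z2 f.
Variable s : 'rV[R]_k.
Hypothesis s0 : forall j, 0 <= s 0 j.

(** The support is restricted because [dot s g <= c^-1] bounds [g 0 j] only where [s 0 j] is
    positive. *)
Definition supported_solution : set 'rV[R]_k :=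
  [set t | [/\ forall j, 0 <= t 0 j, forall j, t 0 j != 0 -> 0 < s 0 j &
               Z2 (f + \sum_j t 0 j *: r j)]].

(** Finitely many solutions are handled by [finite_separation], rescaled to give [s] the weight
    [c^-1]; the finite intersection property in [K] then handles all of them at once. *)
Lemma compact_separation (c : R) : 0 < c -> 0 < \sum_j s 0 j ->
  ~ relaxed_corner f r (c *: s) ->
  exists g : 'rV[R]_k, [/\ forall j, 0 <= g 0 j, dot s g <= c^-1 &
    forall t, supported_solution t -> 1 <= dot t g].
Proof.
move=> c0 sp Cs.
have dot_closed (u : 'rV[R]_k) : forall A, closed A -> closed (dot u @^-1` A).
  by apply/continuous_closedP; exact: dot_continuous.
(* Where [s 0 j = 0], the upper bound is 0 as well, because [0^-1 = 0]. *)
pose box := [set g : 'rV[R]_k | forall j, `[0, c^-1 / s 0 j]%classic (g ord0 j)].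
pose K := box `&` (dot s @^-1` [set x | x <= c^-1]).
have Kc : compact K.
  apply: compact_closedI.
    apply: (@rV_compact _ _ (fun j => `[0, c^-1 / s 0 j]%classic)) => j.
    exact: segment_compact.
  by apply: dot_closed; exact: closed_le.
pose F (t : 'rV[R]_k) := K `&` (dot t @^-1` [set x | 1 <= x]).
have := Kc; rewrite compact_In0 => /(_ _ supported_solution F) [].
- exists (fun t => dot t @^-1` [set x | 1 <= x]) => // t _.
  by apply: dot_closed; exact: closed_ge.
- move=> D DS; pose e := finmap.enum_fset D.
  pose t (i : 'I_(size e)) := nth 0 e i.
  have tS i : supported_solution (t i).
    by apply/set_mem/DS/mem_nth.
  have [i|g [g0 gP]] := @finite_separation _ _ _ _ rQ _ t (c *: s) _ Cs.
    by apply: sub_conv_hull; have [] := tS i; split.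
  have gs0 : 0 < dot s g.
    have [j sj] : exists j, 0 < s 0 j.
      apply: contrapT => /forallNP h; have : \sum_j s 0 j = 0.
        by apply: big1 => j _; apply/eqP; rewrite eq_le s0 leNgt; have/negP-> := h j.
      by move=> S0; rewrite S0 ltxx in sp.
    rewrite /dot (bigD1 j)//= ltr_pwDl ?mulr_gt0// sumr_ge0// => i _.
    by rewrite mulr_ge0// ltW.
  pose a := c^-1 / dot s g.
  have a0 : 0 < a by rewrite divr_gt0// invr_gt0.
  pose h : 'rV[R]_k := \row_j (if 0 < s 0 j then a * g 0 j else 0).
  have hE (u : 'rV[R]_k) : (forall j, u 0 j != 0 -> 0 < s 0 j) -> dot u h = a * dot u g.
    move=> us; rewrite mulr_sumr; apply: eq_bigr => j _; rewrite mxE.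
    have [->|/us ->] := eqVneq (u 0 j) 0; first by rewrite !mul0r mulr0.
    by rewrite mulrCA.
  have sh : dot s h = c^-1.
    rewrite hE => [|j sj]; last by rewrite lt_neqAle eq_sym sj s0.
    by rewrite divfK// gt_eqF.
  have Kh : K h.
    split; last by rewrite /= sh.
    move=> j; rewrite /= in_itv/= mxE; case: ifP => sj; last first.
      by rewrite lexx/= mulr_ge0 ?invr_ge0 ?(ltW c0)// s0.
    rewrite mulr_ge0 ?(ltW a0) ?(ltW (g0 j))//= ler_pdivlMr// -sh /dot (bigD1 j)//= mxE sj.
    rewrite mulrC lerDl sumr_ge0// => i _; rewrite mxE mulr_ge0 ?s0//.
    by case: ifP => // _; rewrite mulr_ge0 ?(ltW a0) ?(ltW (g0 i)).
  exists h => u /= uD; split=> //=.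
  have ui : (index u e < size e)%N by rewrite index_mem.
  have [_ us _] := tS (Ordinal ui); have := gP (Ordinal ui).
  move: us; rewrite /t /= nth_index// => us.
  rewrite (hE _ us) dotZr (dotC g s) (dotC g u) => lt.
  have <- : a * (c * dot s g) = 1.
    by rewrite /a; field; rewrite !gt_eqF.
  by rewrite ler_pM2l// ltW.
move=> g gP.
have [[t tS]|noS] := pselect (exists t, supported_solution t).
  have [[gb gs] _] := gP t tS.
  exists g; split=> [j||u /gP[]//]; last exact: gs.
  by have := gb j; rewrite /= in_itv/= => /andP[].
exists 0; split=> [j||t tS]; first by rewrite mxE.
  by rewrite /dot big1 ?invr_ge0 ?ltW// => j _; rewrite mxE mulr0.
by case: noS; exists t.
Qed.

(** Raising all weights by [eta] uses up half of the gap between [c^-1] and 2/3. It makes the bound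
    on solutions strict because no solution is 0, [f] not being a lattice point. *)
Lemma separating_weights (c : R) : 3 / 2 < c -> ~ relaxed_corner f r (c *: s) ->
  exists gam : 'I_k -> R, [/\ forall j, 0 < gam j,
    forall t, supported_solution t -> 1 < \sum_j gam j * t 0 j &
    \sum_j gam j * s 0 j < 2 / 3].
Proof.
move=> c32 Cs; have c0 : 0 < c by lra.
have nz t : supported_solution t -> exists j, 0 < t 0 j.
  move=> [t0 _ tZ]; apply: contrapT => /forallNP h; apply: fZ.
  move: tZ; rewrite big1 ?addr0// => j _.
  suff -> : t 0 j = 0 by rewrite scale0r.
  by apply/eqP; rewrite eq_le t0 leNgt; have/negP-> := h j.
have S0 : 0 <= \sum_j s 0 j by apply: sumr_ge0.
have [S00|Sn] := eqVneq (\sum_j s 0 j) 0.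
  have sj j : s 0 j = 0.
    have /eqP := S00; rewrite psumr_eq0// => /allP/(_ j).
    by rewrite mem_index_enum => /(_ isT)/= /eqP.
  exists (fun=> 1); split=> // [t tS|].
    have [j tj] := nz t tS; have [_ ts _] := tS.
    by have := ts j; rewrite gt_eqF// sj ltxx => /(_ isT).
  by rewrite big1 ?divr_gt0// => j _; rewrite sj mulr0.
have Sp : 0 < \sum_j s 0 j by rewrite lt_neqAle eq_sym Sn.
have [g [g0 gs gP]] := compact_separation c0 Sp Cs.
have c1 : c^-1 < 2 / 3.
  by rewrite invf_plt ?posrE// invf_div.
pose eta := (2 / 3 - c^-1) / (2 * \sum_j s 0 j).
have eta0 : 0 < eta by rewrite divr_gt0 ?mulr_gt0// subr_gt0.
have sumE (u : 'rV[R]_k) :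
    \sum_j (g 0 j + eta) * u 0 j = dot u g + eta * \sum_j u 0 j.
  rewrite mulr_sumr /dot -big_split; apply: eq_bigr => j _ /=.
  by rewrite mulrDl (mulrC (g 0 j)).
exists (fun j => g 0 j + eta); split=> [j|t tS|].
- by rewrite ltr_wpDl.
- rewrite sumE; have := gP t tS; have [j tj] := nz t tS; have [t0 _ _] := tS.
  have : 0 < \sum_j t 0 j by rewrite (bigD1 j)//= ltr_pwDl// sumr_ge0.
  by move=> /(mulr_gt0 eta0); lra.
rewrite sumE.
have : eta * \sum_j s 0 j = (2 / 3 - c^-1) / 2.
  by rewrite /eta invfM -!mulrA mulVf ?mulr1.
by lra.
Qed.

End separation.

Theorem corollary3p6 (R : realType) (k : nat) (f : 'rV[R]_2)
    (r : 'I_k -> 'rV[R]_2)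
    (hk : (1 <= k)%N) (fQ : Q2 f) (fZ : ~ Z2 f)
    (rQ : forall j, Q2 (r j)) (r0 : forall j, r j <> 0) :
  quadrilateral_closure f r `<=` scaled (171 / 100) (relaxed_corner f r).
Proof.
move=> s sQ; apply: contrapT => Cs.
have s0 j : 0 <= s 0 j by have [h _] := sQ; exact: h.
have [|gam [gam0 gamZ gams]] := separating_weights rQ fZ s0 _ Cs; first lra.
have gam0' j : 0 < s 0 j -> 0 < gam j by [].
have Good0 b : separates f r s gam 0 b -> 0 < b.
  by case; rewrite dot2E /vecR !(vec2_0, vec2_1) /= !mul0r addr0 ltr0z.
have GoodW n b b' : separates f r s gam n b -> b <= b' -> separates f r s gam n b'.
  move=> [h1 h2] bb'; have bbR : (b%:~R : R) <= b'%:~R by rewrite ler_int.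
  by split=> [|j sj]; [exact: lt_le_trans h1 bbR|exact: lt_le_trans (h2 j sj) bbR].
have cov : exists N (n : 'I_N -> vecz) b, lattice_cover (separates f r s gam) n b.
  by apply: separates_cover => // t t0 ts tZ; apply: gamZ; split.
have [|] := cover_outcome GoodW Good0 cov.
  move=> /(quad_outcome_cut r0 sQ gam0'); lra.
move=> /(pinwheel_outcome_cut r0 sQ gam0'); lra.
Qed.
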